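(* The path $t\mapsto Au_t$, where $u_t$ is a minimizer of $E_t^{1,1}(\cdot;f)$ (this $\mathcal H$-valued path being uniquely determined for almost every $t>0$), is of bounded variation on $(\delta,\infty)$ for all $\delta>0$, and on $[0,\infty)$ if $t_*>0$. Furthermore, the jump part of the ($\mathcal H$-valued) measure $(Au_t)'$ (distributional derivative in $t$) is supported in $[t_*,t_{**}]$.
   Context: Setting: $\mathcal X$ is the (real) Banach space dual of a separable Banach space $\mathcal Y$; $\mathcal H$ is a real Hilbert space; $A:\mathcal X\to\mathcal H$ is bounded and linear, with adjoint $A^*:\mathcal H\to\mathcal X^*$, $\langle A^*q,u\rangle=\langle q,Au\rangle$. $J:\mathcal X\to[0,\infty]$ is convex, proper, weak$^*$ lower semi-continuous and absolutely one-homogeneous ($J(cu)=|c|J(u)$). $\mathcal N(J)=\{u:J(u)=0\}$, $\mathrm{dom}(J)=\{u:J(u)<\infty\}$, and $\partial J(u)=\{p\in\mathcal X^*: J(u)+\langle p,v-u\rangle\le J(v)\ \forall v\in\mathcal X\}$. The datum $f\in\mathcal H$ is such that any $u\in\mathcal X$ with $Au=f$ satisfies $J(u)\ne 0$. $E_t^{1,1}(u;f)=\|Au-f\|_{\mathcal H}+tJ(u)$ for $u\in\mathcal X$. For $g\in\mathcal H$, $\mathcal P^A(g)\in\mathcal N(J)$ denotes the (unique) minimizer of $\|Au-g\|_{\mathcal H}$ over $u\in\mathcal N(J)$. Standing assumptions: (1) $u\mapsto\|Au\|_{\mathcal H}$ is a norm on $\mathcal N(J)$ equivalent to the restriction of $\|\cdot\|_{\mathcal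 X}$. (2) There is $C>0$ with $\|u-\mathcal P^A(Au)\|_{\mathcal X}\le C J(u)$ for all $u\in\mathcal X$. (3) $A$ is weak$^*$-to-weak continuous: $u_k\rightharpoonup^* u$ in $\mathcal X$ implies $Au_k\rightharpoonup Au$ in $\mathcal H$. Definition of $t_*$: if there are $u^\dagger\in\mathrm{dom}(J)$ with $Au^\dagger=f$ and $q\in\mathcal H$ with $A^*q\in\partial J(u^\dagger)$, put $t_*:=1/s_*$, where $s_*:=\inf\{\|q\|_{\mathcal H}: q\in\mathcal H,\ A^*q\in\partial J(u)\text{ for some }u\in\mathrm{dom}(J)\text{ with }Au=f\}\in(0,\infty)$; otherwise $t_*:=0$. Definition of $t_{**}$: $t_{**}:=S(f)/\|f-A\mathcal P^A(f)\|_{\mathcal H}$, where $S(f):=\sup\{\langle f,Au\rangle: u\in\mathcal X,\ J(u)=1,\ \langle Au,Av\rangle=0\ \forall v\in\mathcal N(J)\}<\infty$ (note $f\neq A\mathcal P^A(f)$ by the assumption on $f$). *)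

(* Defs.v *)
From HB Require Import structures.
From mathcomp Require Import all_boot all_order all_algebra.
From mathcomp Require Import all_classical all_reals all_analysis.
Set Implicit Arguments.
Unset Strict Implicit.
Unset Printing Implicit Defensive.
Import Order.TTheory GRing.Theory Num.Theory.
Import numFieldNormedType.Exports.
Local Open Scope classical_set_scope.
Local Open Scope ring_scope.

Section spaces.
Context {R : realType}.

Definition separable (T : topologicalType) :=
  exists D : set T, countable D /\ dense D.

(* A complete normed module with such an [ip] is a real Hilbert space. *)
Definition is_inner_product (H : normedModType R) (ip : H -> H -> R) :=
  [/\ forall x y, ip x y = ip y x,
      forall x, scalar (ip x)
    & forall x, ip x x = `|x| ^+ 2].

(* [pair] identifies [X] isometrically with the space of all continuous linear
   functionals on [Y], equipped with the dual norm. *)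
Definition is_dual_pairing (X Y : normedModType R) (pair : X -> Y -> R) :=
  [/\ forall y, scalar (pair^~ y),
      forall x, scalar (pair x) /\ continuous (pair x),
      forall x, `|x| = sup [set `|pair x y| | y in [set y | `|y| <= 1]]
    & forall phi : Y -> R, scalar phi -> continuous phi ->
        exists x, pair x = phi].

(* The topology of pointwise convergence on [Y]. *)
Definition weak_star {X Y : normedModType R} (pair : X -> Y -> R) :
    topologicalType :=
  initial_topology (pair : X -> {ptws Y -> R}).

Definition weak_star_cvg {X Y : normedModType R} (pair : X -> Y -> R)
    (u_ : nat -> X) (u : X) :=
  forall y, pair (u_ k) y @[k --> \oo] --> pair u y.

Definition weak_cvg {H : normedModType R} (ip : H -> H -> R)
    (h_ : nat -> H) (h : H) :=
  forall g, ip (h_ k) g @[k --> \oo] --> ip h g.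

Definition weak_star_lsc {X Y : normedModType R} (pair : X -> Y -> R)
    (J : X -> \bar R) :=
  lower_semicontinuous (J : weak_star pair -> \bar R).

End spaces.

Section functional.
Context {R : realType} {X : normedModType R}.
Variable J : X -> \bar R.
Local Open Scope ereal_scope.

Definition convex_functional := forall (l : R) (u v : X),
  (0 <= l <= 1)%R ->
  J (l *: u + (1 - l) *: v)%R <= l%:E * J u + (1 - l)%:E * J v.

Definition proper_functional := exists u, J u < +oo.

Definition abs_one_homogeneous := forall (c : R) (u : X),
  J (c *: u)%R = `|c|%:E * J u.

Definition nullset : set X := [set u | J u = 0].

Definition dom : set X := [set u | J u < +oo].

Definition subdifferential (u : X) : set (X -> R) :=
  [set p : X -> R | [/\ scalar p, continuous p
             & forall v, J u + (p (v - u)%R)%:E <= J v]].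

End functional.

Section variational.
Context {R : realType} {X H : normedModType R}.
Variables (ip : H -> H -> R) (A : X -> H) (J : X -> \bar R).

Definition adjoint (q : H) : X -> R := fun u => ip q (A u).

Definition energy (f : H) (t : R) (u : X) : \bar R :=
  (`|A u - f|%:E + t%:E * J u)%E.

Definition is_minimizer (f : H) (t : R) (u : X) :=
  forall v, (energy f t u <= energy f t v)%E.

Definition is_null_proj (g : H) (u : X) :=
  nullset J u /\ forall v, nullset J v -> `|A u - g| <= `|A v - g|.

Definition null_proj (g : H) : X := xget 0 [set u | is_null_proj g u].

Definition source_elements (f : H) : set H :=
  [set q | exists u, [/\ dom J u, A u = f & subdifferential J u (adjoint q)]].

Definition t_star (f : H) : R :=
  if `[< source_elements f !=set0 >]
  then (inf [set `|q| | q in source_elements f])^-1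
  else 0.

(* Extended-real supremum, so that no convention is needed on an empty set. *)
Definition sup_ortho (f : H) : \bar R :=
  ereal_sup [set (ip f (A u))%:E | u in
    [set u | J u = 1%E /\ forall v, nullset J v -> ip (A u) (A v) = 0]].

Definition t_star_star (f : H) : \bar R :=
  (sup_ortho f * (`|f - A (null_proj f)|^-1)%:E)%E.

End variational.

Section vector_measures.
Context {R : realType} {H : normedModType R}.
Variable ip : H -> H -> R.

(* A norm-countably additive [H]-valued set function on the Borel sets of [R];
   its values on other sets are irrelevant. *)
Definition is_vector_measure (mu : set R -> H) :=
  mu set0 = 0 /\
  forall F : nat -> set R, (forall n, measurable (F n)) -> trivIset setT F ->
    (\sum_(k < n) mu (F k)) @[n --> \oo] --> mu (\bigcup_n F n).

Definition vector_variation (mu : set R -> H) : \bar R :=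
  ereal_sup [set z | exists (n : nat) (F : nat -> set R),
    [/\ forall k, measurable (F k), trivIset setT F
      & z = (\sum_(k < n) `|mu (F k)|)%:E]].

Definition test_function (I : set R) (phi : R -> R) :=
  [/\ forall (n : nat) (x : R), derivable (derive1n n phi) x 1,
      compact (closure [set x | phi x != 0])
    & closure [set x | phi x != 0] `<=` I].

(* On the open set [I], the distributional derivative of [g] is [mu]; as a
   measure on [I], [mu] is extended by zero outside [I]. The identity
   "int g phi' = - int phi dmu" in [H] is tested against every [h], the integral
   with respect to the signed measure <mu, h> being computed from a
   decomposition of it as a difference of finite measures. *)
Definition is_distributional_derivative
    (I : set R) (g : R -> H) (mu : set R -> H) :=
  (forall B, measurable B -> mu B = mu (B `&` I)) /\
  forall h : H, exists p m : {finite_measure set R -> \bar R},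
    (forall B, measurable B -> (ip (mu B) h)%:E = (p B - m B)%E) /\
    forall phi, test_function I phi ->
      \int[lebesgue_measure]_(t in I) (ip (g t) h * derive1 phi t) =
      - (\int[p]_t phi t - \int[m]_t phi t).

Definition locally_integrable_path (I : set R) (g : R -> H) :=
  (forall h, measurable_fun I (fun t => ip (g t) h)) /\
  forall K, compact K -> K `<=` I ->
    lebesgue_measure.-integrable K (fun t => `|g t|%:E).

Definition is_bv_derivative (I : set R) (g : R -> H) (mu : set R -> H) :=
  [/\ locally_integrable_path I g,
      is_vector_measure mu,
      (vector_variation mu < +oo)%E
    & is_distributional_derivative I° g mu].

(* Variation in the sense of distributions, insensitive to (measurable)
   modifications of [g] on a null set, in particular to its value at an endpoint
   of [I]: the path considered is only determined almost everywhere. *)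
Definition bv_path (I : set R) (g : R -> H) :=
  exists mu, is_bv_derivative I g mu.

Definition atoms (mu : set R -> H) : set R := [set t | mu [set t] <> 0].

(* In one dimension the jump part of a derivative is its atomic part. *)
Definition jump_part (mu : set R -> H) : set R -> H :=
  fun B => mu (B `&` atoms mu).

Definition vector_support (nu : set R -> H) : set R :=
  [set t | forall U, nbhs t U ->
    exists B, [/\ measurable B, B `<=` U & nu B <> 0]].

End vector_measures.

(* Main.v *)
Require Import Defs.
From HB Require Import structures.
From mathcomp Require Import all_boot all_order all_algebra.
From mathcomp Require Import all_classical all_reals all_analysis.
From mathcomp Require Import measurable_realfun ring lra.
Import Order.TTheory GRing.Theory Num.Theory.
Import numFieldNormedType.Exports.
Local Open Scope classical_set_scope.
Local Open Scope ring_scope.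

(** Why the statement holds.

    Fix minimizers [u t] and let [tau t] be [t * `|A (u t) - f|]. Comparing the
    energies for two parameters shows that [J (u t)] is nonincreasing and that
    the residual norm, hence [tau], is nondecreasing in [t]. First-order
    optimality identifies [u t] as a minimizer of the quadratic problem
    [1/2 * `|A u - f| ^+ 2 + tau t * J u], and monotonicity of the subdifferential
    of [J] yields, for [0 < t < s], the estimate of [minimizers_dist]:

      [`|A (u s) - A (u t)| <= (tau s - tau t) / t].

    The Poincare inequality makes the path constant for large [t]. So on the right
    of any [delta > 0] the increments of the path are dominated by those of a
    bounded nondecreasing function. If [t_star] is positive, a source element of
    norm less than [1 / t] acts as an exact penalization and the path equals [f]
    on the left of [t_star], which extends the domination down to [0].

    A path [g] dominated by a bounded nondecreasing function [V] has a vector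
    measure as derivative ([bv_path_dominated]). For each [h], the function
    [ip (g _) h] is a difference of two monotone functions, which gives a signed
    Stieltjes measure; these are dominated by [`|h|] times the Stieltjes measure
    of [V], and a Dynkin class argument assembles them into one vector measure
    ([vector_measure_ex]). The distributional identity is integration by parts,
    obtained from Fubini ([stieltjes_by_parts]).

    Minimizers exist by the direct method, through sequential weak-star
    compactness in the dual of a separable space. Two minimizers for the same [t]
    with the same value of [J] have the same image by strict convexity of the
    Hilbert norm, so non-uniqueness of the image forces the monotone function
    [J (u t)] to jump at [t]; this happens at countably many [t] only.

    For the jump part, the path is constant on the left of [t_star], as said, and
    also on the right of [t_star_star]: subtracting from [u] its component in the
    null space of [J] gives a multiple of an admissible element for the supremum
    that defines [t_star_star], which bounds what [J] can gain in the residual.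
    Testing the derivative against smooth bumps shrinking to a point shows that it
    has no atom where the path is locally constant ([bv_derivative_no_atom]). *)

Set Implicit Arguments.
Unset Strict Implicit.
Unset Printing Implicit Defensive.

(** * Inner products *)

Section inner_product.
Context {R : realType} {H : normedModType R} (ip : H -> H -> R).
Hypothesis hip : is_inner_product ip.

Lemma ipC x y : ip x y = ip y x.
Proof. by case: hip. Qed.

Lemma ipxx x : ip x x = `|x| ^+ 2.
Proof. by case: hip. Qed.

Lemma ipDr x y z : ip x (y + z) = ip x y + ip x z.
Proof. by case: hip => _ /(_ x 1 y z); rewrite scale1r mul1r. Qed.

Lemma ip0r x : ip x 0 = 0.
Proof. by have := ipDr x 0 0; rewrite addr0; lra. Qed.

Lemma ipZr x a y : ip x (a *: y) = a * ip x y.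
Proof. by case: hip => _ /(_ x a y 0); rewrite addr0 ip0r addr0. Qed.

Lemma ipNr x y : ip x (- y) = - ip x y.
Proof. by rewrite -scaleN1r ipZr mulN1r. Qed.

Lemma ipBr x y z : ip x (y - z) = ip x y - ip x z.
Proof. by rewrite ipDr ipNr. Qed.

Lemma ipDl x y z : ip (x + y) z = ip x z + ip y z.
Proof. by rewrite !(ipC _ z) ipDr. Qed.

Lemma ip0l x : ip 0 x = 0.
Proof. by rewrite ipC ip0r. Qed.

Lemma ipZl a x y : ip (a *: x) y = a * ip x y.
Proof. by rewrite !(ipC _ y) ipZr. Qed.

Lemma ipNl x y : ip (- x) y = - ip x y.
Proof. by rewrite !(ipC _ y) ipNr. Qed.

Lemma ipBl x y z : ip (x - y) z = ip x z - ip y z.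
Proof. by rewrite ipDl ipNl. Qed.

Lemma sqr_normD (x y : H) : `|x + y| ^+ 2 = `|x| ^+ 2 + 2 * ip x y + `|y| ^+ 2.
Proof. by rewrite -!ipxx ipDl !ipDr (ipC y x); ring. Qed.

Lemma sqr_normB (x y : H) : `|x - y| ^+ 2 = `|x| ^+ 2 - 2 * ip x y + `|y| ^+ 2.
Proof. by rewrite sqr_normD ipNr normrN; ring. Qed.

Lemma ip_le x y : ip x y <= `|x| * `|y|.
Proof.
have [->|x0] := eqVneq x 0; first by rewrite ip0l normr0 mul0r.
have [->|y0] := eqVneq y 0; first by rewrite ip0r normr0 mulr0.
have := sqr_ge0 `| `|y| *: x - `|x| *: y|.
rewrite sqr_normB !normrZ !normr_id ipZl ipZr.
have xy0 : 0 < `|x| * `|y| by rewrite mulr_gt0 ?normr_gt0.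
move=> h; rewrite -(ler_pM2l xy0); move: h xy0.
by set a := `|x|; set b := `|y|; set c := ip x y; nra.
Qed.

Lemma ler_norm_ip x y : `|ip x y| <= `|x| * `|y|.
Proof.
rewrite ler_norml ip_le andbT; have := ip_le (- x) y.
by rewrite ipNl normrN; lra.
Qed.

Lemma parallelogram (x y : H) :
  `|x + y| ^+ 2 + `|x - y| ^+ 2 = 2 * (`|x| ^+ 2 + `|y| ^+ 2).
Proof. by rewrite sqr_normD sqr_normB; ring. Qed.

Lemma ip_inj x y : (forall h, ip x h = ip y h) -> x = y.
Proof.
move=> e; apply/eqP; rewrite -subr_eq0 -normr_eq0 -sqrf_eq0 -ipxx.
by rewrite ipBl e subrr.
Qed.

Lemma cvg_ipl (T : Type) (F : set_system T) (FF : Filter F) (g : T -> H) x h :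
  g @ F --> x -> (ip (g t) h) @[t --> F] --> ip x h.
Proof.
move=> gx; apply/cvgrPdist_le => e e0.
have e1 : 0 < e / (`|h| + 1) by rewrite divr_gt0// ltr_wpDl.
move/cvgrPdist_le : gx => /(_ _ e1); apply: filterS => t xt.
rewrite -ipBl (le_trans (ler_norm_ip _ _))//.
rewrite (@le_trans _ _ (e / (`|h| + 1) * `|h|)) ?ler_wpM2r//.
by rewrite mulrAC ler_pdivrMr ?ltr_wpDl// (ler_wpM2l (ltW e0))// lerDl.
Qed.

(** Weak lower semicontinuity of the norm, obtained by testing the weak
    convergence against the vector [g - f] itself. *)
Lemma weak_cvg_norm_gt (g_ : nat -> H) (g f : H) (a : R) : weak_cvg ip g_ g ->
  a < `|g - f| -> \forall k \near \oo, a < `|g_ k - f|.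
Proof.
move=> gw agf; have [a0|a0] := ltP a 0.
  by near=> k; rewrite (lt_le_trans a0).
have gf0 : 0 < `|g - f| by rewrite (le_lt_trans a0).
have l : (ip (g_ k) (g - f) - ip f (g - f)) @[k --> \oo] -->
         ip g (g - f) - ip f (g - f) by apply: cvgB; [exact: gw|exact: cvg_cst].
have : a * `|g - f| < ip g (g - f) - ip f (g - f).
  by rewrite -ipBl ipxx expr2 ltr_pM2r.
move/(@cvgr_gt _ _ _ _ _ _ l); apply: filterS => k; rewrite -ipBl => h.
by rewrite -(ltr_pM2r gf0) (lt_le_trans h)// ip_le.
Unshelve. all: by end_near. Qed.

End inner_product.

(** * Weak-star sequential compactness *)

Section scalar_functionals.
Context {R : realType} {Y : normedModType R} (phi : Y -> R).
Hypothesis phil : scalar phi.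

Lemma scalarD x y : phi (x + y) = phi x + phi y.
Proof. by have := phil 1 x y; rewrite scale1r mul1r. Qed.

Lemma scalar0 : phi 0 = 0.
Proof. by have := scalarD 0 0; rewrite addr0; lra. Qed.

Lemma scalarZ a x : phi (a *: x) = a * phi x.
Proof. by have := phil a x 0; rewrite !addr0 scalar0 addr0. Qed.

Lemma scalarB x y : phi (x - y) = phi x - phi y.
Proof. by rewrite scalarD -scaleN1r scalarZ mulN1r. Qed.

Lemma bounded_scalar_continuous M : (forall y, `|phi y| <= M * `|y|) ->
  continuous phi.
Proof.
move=> hM x; apply/cvgrPdist_le => e e0.
have M0 : 0 < `|M| + 1 by rewrite ltr_wpDl.
have d0 : 0 < e / (`|M| + 1) by rewrite divr_gt0.
apply/nbhs_ballP; exists (e / (`|M| + 1)) => // y; rewrite -ball_normE /= => xy.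
rewrite -scalarB (le_trans (hM _))// (@le_trans _ _ ((`|M| + 1) * `|x - y|))//.
  by rewrite ler_wpM2r// (le_trans (ler_norm M))// lerDl.
by rewrite -ler_pdivlMl// mulrC ltW.
Qed.

Lemma continuous_scalar_bounded : continuous phi ->
  exists M, forall y, `|phi y| <= M * `|y|.
Proof.
move=> /(_ 0)/cvgrPdist_lt/(_ _ ltr01)/nbhs_ballP[d /= d0 hd].
exists (2 / d) => y; have [->|y0] := eqVneq y 0.
  by rewrite scalar0 !normr0 mulr0.
have y1 : 0 < `|y| by rewrite normr_gt0.
have := hd ((d / 2 / `|y|) *: y).
rewrite -ball_normE /= !sub0r !normrN normrZ.
rewrite ger0_norm ?divr_ge0// ?(ltW d0)// divfK ?gt_eqF//.
rewrite scalar0 sub0r normrN scalarZ normrM ger0_norm ?divr_ge0// ?(ltW d0)//.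
move=> /(_ _)/ltW; rewrite gtr_pMr// ?invf_lt1 ?ltr1n// => /(_ isT).
have -> : d / 2 / `|y| * `|phi y| = `|phi y| / (2 / d * `|y|).
  by field; rewrite !gt_eqF.
by rewrite ler_pdivrMr ?mul1r// mulr_gt0// divr_gt0.
Qed.

End scalar_functionals.

Section weak_star_compactness.
Context {R : realType} {X Y : normedModType R} (pair : X -> Y -> R).
Hypothesis hX : is_dual_pairing pair.

Lemma ler_norm_pair x y : `|pair x y| <= `|x| * `|y|.
Proof.
case: hX => _ hx xE _; have [px cx] := hx x.
have [->|y0] := eqVneq y 0; first by rewrite (scalar0 px) !normr0 mulr0.
have y1 : 0 < `|y| by rewrite normr_gt0.
have [M hM] := continuous_scalar_bounded px cx.
have ub : has_ubound [set `|pair x y| | y in [set y | `|y| <= 1]].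
  exists `|M| => _ [z /= z1 <-]; rewrite (le_trans (hM _))//.
  rewrite (le_trans (ler_norm _))// normrM normr_id ler_piMr//.
have hin : [set `|pair x y| | y in [set y | `|y| <= 1]]
    `|pair x (`|y|^-1 *: y)|.
  exists (`|y|^-1 *: y) => //=.
  by rewrite normrZ normfV normr_id mulVf// gt_eqF.
have := ub_le_sup ub hin; rewrite -xE (scalarZ px) normrM normfV normr_id mulrC.
by rewrite ler_pdivrMr.
Qed.

Lemma pairBr u y z : pair u (y - z) = pair u y - pair u z.
Proof. by case: hX => _ /(_ u)[py _] _ _; exact: (scalarB py). Qed.

(** A bounded real family converges along every ultrafilter; applied to the
    pairings with each element of the predual, this yields a limit functional,
    from which a genuine subsequence is then extracted. *)
Lemma ultra_bounded_cvg (T : Type) (U : set_system T) (g : T -> R) (M : R) :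
  UltraFilter U -> (forall k, `|g k| <= M) -> exists l : R, g @ U --> l.
Proof.
move=> UU gM; have UM : U (g @^-1` [set` `[- M, M]]).
  by apply: (filterS _ (@filterT _ U _)) => k _ /=; rewrite in_itv/= -ler_norml.
have [l [_ cl]] := @segment_compact R (- M) M (g @ U) _ UM.
exists l => V Vl; have [//|UV] := in_ultra_setVsetC (g @^-1` V) UU.
by have [x []] := cl (~` V) V UV Vl.
Qed.

(** Sequential Banach-Alaoglu theorem: a limit functional along an ultrafilter
    is represented by some [u], and indices are then chosen so as to converge on
    a countable dense subset of [Y], which is enough by boundedness. The map [s]
    is a subsequence in the weak sense that it tends to infinity. *)
Lemma bounded_weak_star_cvg (u_ : nat -> X) (M : R) : separable Y ->
  (forall k, `|u_ k| <= M) ->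
  exists (s : nat -> nat) (u : X),
    (forall k, (k <= s k)%N) /\ weak_star_cvg pair (u_ \o s) u.
Proof.
move=> [D [/countable_injP[c cinj] Dd]] uM.
have M0 : 0 <= M by rewrite (le_trans _ (uM 0%N)).
have [U [UU subU]] := ultraFilterLemma (eventually_filter).
have /choice[L LP] y : exists l : R, (pair (u_ k) y) @[k --> U] --> l.
  apply: (@ultra_bounded_cvg _ _ _ (M * `|y|)) => k.
  by rewrite (le_trans (ler_norm_pair _ _))// ler_wpM2r.
have LM y : `|L y| <= M * `|y|.
  apply: (cvgr_to_le (cvg_norm (LP y))); apply: (filterS _ (@filterT _ U _)) => k _.
  by rewrite (le_trans (ler_norm_pair _ _))// ler_wpM2r.
case: (hX) => _ hp _ rep.
have Ll : scalar L.
  move=> a y z; apply: (@cvg_unique _ _ ((fun k => pair (u_ k) (a *: y + z)) @ U)).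
    exact: norm_hausdorff.
    exact: LP.
  have -> : (fun k => pair (u_ k) (a *: y + z)) =
      (fun k => a * pair (u_ k) y + pair (u_ k) z).
    by apply/funext => k; exact: (hp (u_ k)).1.
  by apply: cvgD; [apply: cvgMr|]; exact: LP.
have [u uL] := rep L Ll (bounded_scalar_continuous Ll LM).
(* [d] enumerates the dense set, with junk value [0] off the range of [c]. *)
pose d n := xget 0 [set y | D y /\ c y = n].
have dc y : D y -> d (c y) = y.
  move=> Dy; rewrite /d; case: xgetP => [z -> [Dz cz]|/(_ y)[]//].
  by apply: cinj; rewrite ?inE.
have near_d N e : 0 < e ->
    U [set k | forall n : nat, (n < N)%N -> `|L (d n) - pair (u_ k) (d n)| < e].
  move=> e0; elim: N => [|N IH]; first by apply: (filterS _ (@filterT _ U _)) => k _ n.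
  have /cvgrPdist_lt/(_ _ e0) := LP (d N).
  move=> /(filterI IH); apply: filterS => k [h1 h2] n.
  by rewrite ltnS leq_eqVlt => /orP[/eqP->//|]; exact: h1.
have /choice[s sP] m : exists k, (m <= k)%N /\
    forall n, (n < m)%N -> `|L (d n) - pair (u_ k) (d n)| < m.+1%:R^-1.
  have e0 : 0 < m.+1%:R^-1 :> R by rewrite invr_gt0.
  have Um : U [set k | (m <= k)%N] by apply: subU; exists m.
  by have [k [h1 h2]] := filter_ex (filterI Um (near_d m _ e0)); exists k.
exists s, u; split=> [k|y]; first by have [] := sP k.
apply/cvgrPdist_lt => e e0; rewrite uL.
have e1 : 0 < e / (4 * (M + 1)) by rewrite divr_gt0// mulr_gt0// ltr_wpDl.
have [z [yz Dz]] : ball y (e / (4 * (M + 1))) `&` D !=set0.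
  by apply: Dd; [exists y; exact: ballxx|exact: ball_open].
have Mz (x : R) : `|x| <= M * `|y - z| -> `|x| <= e / 4.
  move=> /le_trans; apply; move: yz; rewrite -ball_normE /= => /ltW yz.
  have M1 : 0 < M + 1 by rewrite ltr_wpDl.
  rewrite (le_trans (ler_wpM2l M0 yz))//.
  have -> : M * (e / (4 * (M + 1))) = M / (M + 1) * (e / 4).
    by field; rewrite gt_eqF.
  by rewrite ler_piMl ?divr_ge0 ?(ltW e0)// ler_pdivrMr// mul1r lerDl.
near=> k.
have -> : L y - (pair \o (u_ \o s)) k y =
    L (y - z) + (L z - pair (u_ (s k)) z) - pair (u_ (s k)) (y - z).
  by rewrite pairBr (scalarB Ll) /=; ring.
have h1 := Mz _ (LM (y - z)).
have h2 : `|pair (u_ (s k)) (y - z)| <= e / 4.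
  by apply: Mz; rewrite (le_trans (ler_norm_pair _ _))// ler_wpM2r.
have h3 : `|L z - pair (u_ (s k)) z| < e / 4.
  rewrite -(dc _ Dz); apply: lt_trans (_ : k.+1%:R^-1 < _).
    by apply: (sP k).2; near: k; exact: nbhs_infty_gt.
  by near: k; apply: near_infty_natSinv_lt (PosNum (divr_gt0 e0 _)).
rewrite (le_lt_trans (ler_normB _ _))// (le_lt_trans (lerD (ler_normD _ _) (lexx _)))//.
lra.
Unshelve. all: by end_near. Qed.

Lemma weak_star_cvg_nbhs (u_ : nat -> X) (u : X) (V : set X) :
  weak_star_cvg pair u_ u -> nbhs (u : weak_star pair) V ->
  \forall k \near \oo, V (u_ k).
Proof.
move=> cu; rewrite nbhsE => -[_ [[B oB <-] Bu] BV].
have cp : {ptws, (pair \o u_) @ \oo --> pair u} by apply/pointwise_cvgP.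
have : nbhs (pair u : {ptws Y -> R}) B by apply: open_nbhs_nbhs.
move=> /cp hB; have {}hB : \forall k \near \oo, B (pair (u_ k)) by [].
by apply: filterS hB => k; exact: BV.
Qed.

Lemma weak_star_lsc_gt (J : X -> \bar R) (u_ : nat -> X) (u : X) (c : R) :
  weak_star_lsc pair J -> weak_star_cvg pair u_ u -> (c%:E < J u)%E ->
  \forall k \near \oo, (c%:E < J (u_ k))%E.
Proof.
move=> lJ cu /lJ[V Vu VJ].
by apply: filterS (weak_star_cvg_nbhs cu Vu) => k; exact: VJ.
Qed.

End weak_star_compactness.

(** * One-homogeneous convex functionals and existence of minimizers *)

Section one_homogeneous.
Context {R : realType} {X : normedModType R} (J : X -> \bar R).
Hypothesis J_ge0 : forall u, (0 <= J u)%E.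
Hypothesis J_convex : convex_functional J.
Hypothesis J_homog : abs_one_homogeneous J.

Lemma homog0 : J 0 = 0%E.
Proof. by have := J_homog 0 0; rewrite scale0r normr0 mul0e. Qed.

Lemma homogN (u : X) : J (- u) = J u.
Proof. by rewrite -scaleN1r J_homog normrN1 mul1e. Qed.

(** Convexity at the midpoint, rescaled by homogeneity. *)
Lemma subadditive_homog u v : (J (u + v)%R <= J u + J v)%E.
Proof.
have h : 0 <= (2^-1 : R) <= 1 by rewrite invr_ge0 ler0n invf_le1// ler1n.
have e : 1 - 2^-1 = 2^-1 :> R by lra.
have := J_convex u v h; rewrite e -scalerDr J_homog ger0_norm ?invr_ge0//.
rewrite -ge0_muleDr// => hle.
by rewrite -(@lee_pmul2l _ (2^-1)%:E) ?lte_fin ?invr_gt0.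
Qed.

Lemma homogD_null (u n : X) : nullset J n -> J (u + n) = J u.
Proof.
move=> Jn; apply/eqP; rewrite eq_le; apply/andP; split.
  by have := subadditive_homog u n; rewrite Jn adde0.
have := subadditive_homog (u + n) (- n).
by rewrite homogN Jn adde0 addrK.
Qed.

Lemma nullset0 : nullset J 0.
Proof. exact: homog0. Qed.

Lemma nullsetD (u v : X) : nullset J u -> nullset J v -> nullset J (u + v).
Proof. by move=> Ju Jv; rewrite /nullset /= homogD_null. Qed.

Lemma nullsetZ a u : nullset J u -> nullset J (a *: u).
Proof. by move=> Ju; rewrite /nullset /= J_homog Ju mule0. Qed.

Lemma dom_fine u : (J u < +oo)%E -> exists2 j : R, 0 <= j & J u = j%:E.
Proof.
move: (J_ge0 u); case: (J u) => [j| |]//.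
by rewrite lee_fin => j0 _; exists j.
Qed.

End one_homogeneous.

Section existence.
Context {R : realType} {Y X H : normedModType R}.
Variables (ip : H -> H -> R) (pair : X -> Y -> R).
Variables (A : {linear X -> H}) (J : X -> \bar R).
Hypothesis hip : is_inner_product ip.
Hypothesis hY : separable Y.
Hypothesis hX : is_dual_pairing pair.
Hypothesis hA : continuous A.
Hypothesis J_ge0 : forall u, (0 <= J u)%E.
Hypothesis J_lsc : weak_star_lsc pair J.
Hypothesis J_homog : abs_one_homogeneous J.
Hypothesis norm_equiv : exists c C : R, [/\ 0 < c, 0 < C &
     forall u, nullset J u -> c * `|u| <= `|A u| /\ `|A u| <= C * `|u|].
Hypothesis poincare : exists C : R, 0 < C /\
     forall u, (`|u - null_proj A J (A u)|%:E <= C%:E * J u)%E.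
Hypothesis A_weak : forall (u_ : nat -> X) (u : X),
     weak_star_cvg pair u_ u -> weak_cvg ip (fun k => A (u_ k)) (A u).

Lemma energy_EFin f t u j : J u = j%:E ->
  energy A J f t u = (`|A u - f| + t * j)%:E.
Proof. by move=> uj; rewrite /energy uj -EFinM -EFinD. Qed.

(** Both terms of the energy are lower semicontinuous, and they are bounded from
    below separately: any [a] and [b] under the two terms at the limit give
    [a + t * b <= m]. Applied with [b] arbitrarily large, this also excludes
    an infinite value of [J] at the limit. *)
Lemma energy_lsc f t u_ u m : 0 < t -> weak_star_cvg pair u_ u ->
  (forall e, 0 < e -> \forall k \near \oo, (energy A J f t (u_ k) <= (m + e)%:E)%E) ->
  (energy A J f t u <= m%:E)%E.
Proof.
move=> t0 cu hE.
have key a b : a < `|A u - f| -> (b%:E < J u)%E -> a + t * b <= m.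
  move=> /(weak_cvg_norm_gt hip (A_weak cu)) ha /(weak_star_lsc_gt J_lsc cu) hb.
  apply/ler_addgt0Pr => e /hE he.
  have [k [h1 [h2 h3]]] := filter_ex (filterI ha (filterI hb he)).
  rewrite -lee_fin (le_trans _ h3)// /energy EFinD leeD// ?lee_fin ?(ltW h1)//.
  by rewrite EFinM lee_pmul2l ?lte_fin// ltW.
have Jfin : (J u < +oo)%E.
  rewrite ltey; apply/eqP => Joo.
  have /(_ _)/= := key (`|A u - f| - 1) ((m + 2 - `|A u - f|) / t).
  by rewrite Joo ltry ltrBlDr ltrDl ltr01 mulrC divfK ?gt_eqF// => /(_ isT isT); lra.
have [j j0 uj] := dom_fine J_ge0 Jfin.
rewrite (energy_EFin _ _ uj) lee_fin; apply/ler_addgt0Pr => e e0.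
have := key (`|A u - f| - e / 2) (j - e / 2 / t).
rewrite uj lte_fin !ltrBlDr !ltrDl !divr_gt0// => /(_ isT isT).
by rewrite mulrBr mulrCA divff ?gt_eqF//; lra.
Qed.

Lemma linear_norm_bound : exists2 K : R, 0 < K & forall u, `|A u| <= K * `|u|.
Proof.
have /linear_boundedP h : bounded_near A (nbhs 0) by apply/linear_bounded_continuous.
near +oo_R => K; exists K; first by near: K; exact: nbhs_pinfty_gt.
near: K; exact: h.
Unshelve. all: by end_near. Qed.

Lemma nullset_null_proj g : nullset J (null_proj A J g).
Proof.
by rewrite /null_proj; case: xgetP => [_ _ []//|_]; exact: nullset0.
Qed.

(** The Poincare inequality controls the distance to the null space of [J], on
    which the norm is equivalent to [`|A _|]. *)
Lemma coercive : exists2 K : R, 0 < K &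
  forall u j, J u = j%:E -> `|u| <= K * (`|A u| + j).
Proof.
have [c [C1 [c0 _ hc]]] := norm_equiv; have [C [C0 hC]] := poincare.
have [K K0 hK] := linear_norm_bound.
exists ((1 + K / c) * C + c^-1) => [|u j uj].
  by rewrite addr_gt0 ?invr_gt0// mulr_gt0// addr_gt0// divr_gt0.
have j0 : 0 <= j by rewrite -lee_fin -uj.
set P := null_proj A J (A u).
have h1 : `|u - P| <= C * j by have := hC u; rewrite uj -EFinM lee_fin.
have h2 : `|P| <= c^-1 * `|A P|.
  by rewrite ler_pdivlMl//; apply: (hc P _).1; exact: nullset_null_proj.
have h3 : `|A P| <= K * (C * j) + `|A u|.
  rewrite -[A P](subrK (A u)) (le_trans (ler_normD _ _))// lerD2r.
  rewrite distrC -linearB (le_trans (hK _))// ler_wpM2l// ltW//.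
have h4 : `|u| <= `|u - P| + `|P| by rewrite -{1}[u](subrK P) ler_normD.
apply: (le_trans h4); apply: (le_trans (lerD h1 h2)).
have ci : 0 < c^-1 by rewrite invr_gt0.
have := ler_wpM2l (ltW ci) h3 => h5.
have a0 := normr_ge0 (A u).
have e1 : 0 <= (1 + K / c) * C * `|A u|.
  by rewrite !mulr_ge0// ?ltW// addr_gt0// divr_gt0.
have e2 : 0 <= c^-1 * j by rewrite mulr_ge0// ltW.
move: h5 e1 e2; set d := c^-1; nra.
Qed.

(** The direct method, stated for a class [P] of competitors that need not be
    weak-star closed: with the domain of [J] it yields minimizers of the energy,
    with the null space of [J] it yields the projections [null_proj]. *)
Lemma exists_energy_min (P : set X) (f : H) (t : R) : 0 < t ->
  P !=set0 -> (forall u, P u -> J u < +oo)%E ->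
  exists (m : R) (u_ : nat -> X) (u : X),
    [/\ forall v, P v -> (m%:E <= energy A J f t v)%E,
        forall k, P (u_ k), weak_star_cvg pair u_ u
      & (energy A J f t u <= m%:E)%E].
Proof.
move=> t0 [v0 Pv0] Pfin.
pose E := [set x : R | exists u j, [/\ P u, J u = j%:E & x = `|A u - f| + t * j]].
have E0 : lbound E 0.
  move=> _ [u [j [_ uj ->]]]; rewrite addr_ge0// mulr_ge0 ?(ltW t0)//.
  by rewrite -lee_fin -uj.
have iE : has_inf E.
  split; last by exists 0.
  have [j _ vj] := dom_fine J_ge0 (Pfin _ Pv0).
  by exists (`|A v0 - f| + t * j), v0, j.
have /choice[u_ hu] k : exists u, exists2 j, P u /\ J u = j%:E &
    `|A u - f| + t * j < inf E + k.+1%:R^-1.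
  have [|_ [u [j [Pu uj ->]]] h] := @inf_adherent _ E k.+1%:R^-1 _ iE.
    by rewrite invr_gt0.
  by exists u, j.
have [K K0 hK] := coercive.
have ub k : `|u_ k| <= K * ((1 + t^-1) * (inf E + 1) + `|f|).
  have [j [_ uj] h] := hu k.
  rewrite (le_trans (hK _ _ uj))// ler_wpM2l ?(ltW K0)//.
  have j0 : 0 <= j by rewrite -lee_fin -uj.
  have h1 : `|A (u_ k) - f| + t * j < inf E + 1.
    rewrite (lt_le_trans h)// lerD2l invf_le1// ler1n//.
  have h2 : `|A (u_ k)| <= `|A (u_ k) - f| + `|f|.
    by rewrite -{1}[A _](subrK f) ler_normD.
  have tj : 0 <= t * j by rewrite mulr_ge0// ltW.
  have h3 : j <= t^-1 * (inf E + 1).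
    rewrite ler_pdivlMl//; have := normr_ge0 (A (u_ k) - f); lra.
  lra.
have [s [u [hs cu]]] := bounded_weak_star_cvg hX hY ub.
exists (inf E), (u_ \o s), u; split => //.
- move=> v Pv; have [j _ vj] := dom_fine J_ge0 (Pfin _ Pv).
  by rewrite (energy_EFin _ _ vj) lee_fin; apply: ge_inf; [exists 0|exists v, j].
- by move=> k /=; have [j []] := hu (s k).
apply: (energy_lsc t0 cu) => e e0; near=> k => /=.
have [j [_ uj] h] := hu (s k).
rewrite (energy_EFin _ _ uj) lee_fin (le_trans (ltW h))// lerD2l.
apply: (@le_trans _ _ k.+1%:R^-1).
  by rewrite lef_pV2 ?posrE// ler_nat ltnS hs.
by apply/ltW; near: k; exact: (near_infty_natSinv_lt (PosNum e0)).
Unshelve. all: by end_near. Qed.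

Lemma exists_minimizer f t : 0 < t -> exists u, is_minimizer A J f t u.
Proof.
move=> t0; have [||m [u_ [u [hm _ _ hu]]]] := @exists_energy_min (dom J) f t t0.
- by exists 0; rewrite /dom /= homog0.
- by [].
exists u => v; have [Jv|] := ltP (J v) +oo%E; first by rewrite (le_trans hu) ?hm.
by rewrite leye_eq /energy => /eqP ->; rewrite gt0_muley ?addey ?leey// lte_fin.
Qed.

Lemma is_null_proj_null_proj g : is_null_proj A J g (null_proj A J g).
Proof.
have [||m [u_ [u [hm Pu cu hu]]]] := @exists_energy_min (nullset J) g 1 ltr01.
- by exists 0; exact: nullset0.
- by move=> u ->.
rewrite /null_proj; case: xgetP => [_ -> //|/(_ u)[]].
have Ju : J u = 0%E.
  apply/eqP; rewrite eq_le J_ge0 andbT leNgt; apply/negP => J0.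
  have : \forall k \near \oo, (0%:E < J (u_ k))%E by apply: weak_star_lsc_gt cu J0.
  by move=> /filter_ex[k]; rewrite Pu ltxx.
split => // v Jv; rewrite -lee_fin.
have := le_trans hu (hm _ Jv).
by rewrite !(energy_EFin _ _ (j := 0))// mulr0 !addr0.
Qed.

End existence.

(** * Comparison of minimizers for different parameters *)

(** Each jump contains a rational, and the levels on its two sides make the
    rationals of distinct jump points distinct. The bound [c] serves functions
    that are monotone on a half-line only. *)
Lemma countable_jumps (R : realType) (c : R) (F : R -> R) :
  countable [set t | c < t /\ exists a b, [/\ a < b,
    forall s, c < s -> s < t -> F s <= a & forall s, t < s -> b <= F s]].
Proof.
set D := [set t | _].
have /choice[p hp] t : exists p : rat, D t -> exists a b, [/\ a < ratr p, ratr p < b,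
    forall s, c < s -> s < t -> F s <= a & forall s, t < s -> b <= F s].
  have [[_ [a [b [ab h1 h2]]]]|nD] := pselect (D t); last by exists 0.
  have [p /itvP pab] := rat_in_itvoo ab.
  by exists p => _; exists a, b; split => //; rewrite pab.
apply/countable_injP; exists (choice.pickle \o p) => t t'.
rewrite !inE => Dt Dt' /(pcan_inj choice.pickleK) pp.
have lt x y : D x -> D y -> p x = p y -> x < y -> False.
  move=> Dx Dy pxy xy.
  have [a [b [_ pb _ h2]]] := hp _ Dx.
  have [a' [b' [pa' _ h1' _]]] := hp _ Dy.
  have xm : x < (x + y) / 2 by lra.
  have my : (x + y) / 2 < y by lra.
  have := h2 _ xm; have := h1' _ (lt_trans Dx.1 xm) my.
  by move: pa' pb; rewrite pxy; lra.
by have [/lt|/lt|//] := ltgtP t t'; [move/(_ Dt Dt' pp)|move/(_ Dt' Dt (esym pp))].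
Qed.

Section minimizers.
Context {R : realType} {X H : normedModType R}.
Variables (ip : H -> H -> R) (A : {linear X -> H}) (J : X -> \bar R) (f : H).
Hypothesis hip : is_inner_product ip.
Hypothesis J_ge0 : forall u, (0 <= J u)%E.
Hypothesis J_convex : convex_functional J.
Hypothesis J_homog : abs_one_homogeneous J.

Lemma minimizer_fin t u : 0 < t -> is_minimizer A J f t u ->
  exists j : R, [/\ 0 <= j, J u = j%:E &
    forall v i, J v = i%:E -> `|A u - f| + t * j <= `|A v - f| + t * i].
Proof.
move=> t0 um.
have Ju : (J u < +oo)%E.
  have := um 0; rewrite (energy_EFin _ _ _ (homog0 J_homog)) /energy.
  by case: (J u) => [j _|/=|//]; rewrite ?ltry// gt0_muley ?lte_fin// addey.
have [j j0 uj] := dom_fine J_ge0 Ju; exists j; split=> // v i vi.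
by have := um v; rewrite (energy_EFin _ _ _ uj) (energy_EFin _ _ _ vi) lee_fin.
Qed.

(** Add the two inequalities saying that each minimizer beats the other one. *)
Lemma minimizers_mono t s u v j i : 0 < t -> t < s ->
  is_minimizer A J f t u -> is_minimizer A J f s v ->
  J u = j%:E -> J v = i%:E -> i <= j /\ `|A u - f| <= `|A v - f|.
Proof.
move=> t0 ts ut vs uj vi; have s0 := lt_trans t0 ts.
have [j' [_ uj' hu]] := minimizer_fin t0 ut.
have [i' [_ vi' hv]] := minimizer_fin s0 vs.
move: uj' vi'; rewrite uj vi => -[?] -[?]; subst j' i'.
have h1 := hu _ _ vi; have h2 := hv _ _ uj.
have ij : i <= j by nra.
by split => //; nra.
Qed.

(** Two minimizers for the same parameter with the same value of [J] have the
    same residual norm, and their midpoint would do better if their images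
    differed: strict convexity of the Hilbert norm. *)
Lemma minimizers_eq t u v : 0 < t -> is_minimizer A J f t u ->
  is_minimizer A J f t v -> J u = J v -> A u = A v.
Proof.
move=> t0 um vm Juv.
have [j [_ uj hu]] := minimizer_fin t0 um.
have [i [_ vi hv]] := minimizer_fin t0 vm.
have ij : i = j by move: Juv; rewrite uj vi => -[].
subst i; have h1 := hu _ _ vi; have h2 := hv _ _ uj.
have h : 0 <= (2^-1 : R) <= 1 by rewrite invr_ge0 ler0n invf_le1// ler1n.
pose w := 2^-1 *: u + (1 - 2^-1) *: v.
have := J_convex u v h; rewrite uj vi -!EFinM -EFinD -/w => Jw.
have Jwoo : (J w < +oo)%E by rewrite (le_lt_trans Jw)// ltry.
have [k k0 wk] := dom_fine J_ge0 Jwoo; move: Jw; rewrite wk lee_fin => kj.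
have h3 := hu _ _ wk.
have := parallelogram hip (A u - f) (A v - f).
have -> : (A u - f) + (A v - f) = 2 *: (A w - f).
  rewrite /w (linearD A) !linearZ_LR/= scalerBr scalerDr !scalerA.
  have -> : 2 * 2^-1 = 1 :> R by lra.
  have -> : 2 * (1 - 2^-1) = 1 :> R by lra.
  by rewrite !scale1r scaler_nat mulr2n opprD addrACA.
rewrite opprB addrA subrK normrZ ger0_norm// => par.
apply/eqP; rewrite -subr_eq0 -normr_eq0 -sqrf_eq0 eq_le sqr_ge0 andbT.
have := normr_ge0 (A u - f); have := normr_ge0 (A w - f).
move: h1 h2 h3 par kj.
set a := `|A u - f|; set b := `|A v - f|; set c := `|A w - f| => h1 h2 h3 par kj.
have ab : a = b by lra.
have ac : a <= c by nra.
by subst b; nra.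
Qed.

(** First-order optimality: the one-sided derivative of the energy at [u] in the
    direction [v - u] is nonnegative. *)
Lemma minimizer_VI t u v j i : 0 < t -> is_minimizer A J f t u ->
  J u = j%:E -> J v = i%:E ->
  ip (f - A u) (A (v - u)) <= t * `|A u - f| * (i - j).
Proof.
move=> t0 um uj vi.
have [j' [_ uj' hu]] := minimizer_fin t0 um.
move: uj'; rewrite uj => -[?]; subst j'.
have [a0|a0] := eqVneq `|A u - f| 0.
  have -> : f - A u = 0 by apply/eqP; rewrite -normr_eq0 distrC a0.
  by rewrite (ip0l hip) a0 mulr0 mul0r.
have {}a0 : 0 < `|A u - f| by rewrite lt_neqAle eq_sym a0/=.
apply/ler_addgt0Pr => e e0.
pose d := t * (i - j); pose n := `|A (v - u)|.
have n0 : 0 <= n by rewrite normr_ge0.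
(* Small enough for [l] to be a convex weight, for the lower bound [a - l * d] of
   the residual norm to be squared, and for the second-order term to be below
   [e]. *)
pose l := Num.min 1 (Num.min (`|A u - f| / (`|d| + 1)) (e / (n ^+ 2 + 1))).
have d1 : 0 < `|d| + 1 by rewrite ltr_wpDl.
have n1 : 0 < n ^+ 2 + 1 by rewrite ltr_wpDl// sqr_ge0.
have l0 : 0 < l by rewrite !lt_min ltr01 !divr_gt0.
have l1 : l <= 1 by rewrite ge_min lexx.
have ld : l * (`|d| + 1) <= `|A u - f|.
  by rewrite -ler_pdivlMr// /l !ge_min lexx !orbT.
have ln : l * (n ^+ 2 + 1) <= e.
  by rewrite -ler_pdivlMr// /l !ge_min lexx !orbT.
have h : 0 <= l <= 1 by rewrite (ltW l0).
pose w := l *: v + (1 - l) *: u.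
have := J_convex v u h; rewrite uj vi -!EFinM -EFinD -/w => Jw.
have Jwoo : (J w < +oo)%E by rewrite (le_lt_trans Jw)// ltry.
have [k k0 wk] := dom_fine J_ge0 Jwoo; move: Jw; rewrite wk lee_fin => kj.
have h3 := hu _ _ wk.
have Aw : A w - f = (A u - f) + l *: A (v - u).
  rewrite /w (linearB A) (linearD A) !linearZ_LR/= scalerBl scale1r scalerBr.
  by rewrite addrCA addrAC.
have := sqr_normD hip (A u - f) (l *: A (v - u)).
rewrite -Aw normrZ (gtr0_norm l0) (ipZr hip) -/n.
rewrite -[A u - f]opprB (ipNl hip) normrN [`|f - _|]distrC.
move: h3 ld; have := ler_norm d; rewrite -/d.
have -> : t * `|A u - f| * (i - j) = `|A u - f| * d by rewrite /d; ring.
have := normr_ge0 (A w - f).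
set a := `|A u - f|; set c := `|A w - f|; set q := ip _ _ => c0 dd h3 ld sq.
have h4 : a - l * d <= c.
  have : t * (k - j) <= l * d by rewrite /d; nra.
  by lra.
have h5 : 0 <= a - l * d by nra.
have h6 : (a - l * d) ^+ 2 <= c ^+ 2 by rewrite ler_sqr ?nnegrE.
rewrite -(ler_pM2l l0).
by nra.
Qed.

(** With [tau = t * `|A u - f|], the inequality of [minimizer_VI] is the
    optimality condition for [1/2 * `|A u - f| ^+ 2 + tau * J u]. Adding the
    conditions for the two parameters, each multiplied by the other [tau],
    eliminates [J] and leaves an estimate of the images alone. *)
Lemma minimizers_dist t s u v : 0 < t -> t < s ->
  is_minimizer A J f t u -> is_minimizer A J f s v ->
  `|A v - A u| <= (s * `|A v - f| - t * `|A u - f|) / t.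
Proof.
move=> t0 ts um vm; have s0 := lt_trans t0 ts.
have [j [j0 uj _]] := minimizer_fin t0 um.
have [i [i0 vi _]] := minimizer_fin s0 vm.
have [ij rr] := minimizers_mono t0 ts um vm uj vi.
have V1 := minimizer_VI t0 um uj vi.
have V2 := minimizer_VI s0 vm vi uj.
rewrite ler_pdivlMr//.
have [a0|a0] := eqVneq `|A u - f| 0.
  have -> : A u = f by apply/eqP; rewrite -subr_eq0 -normr_eq0 a0.
  by rewrite subrr normr0 mulr0 subr0 mulrC ler_wpM2r// ltW.
have [D0|D0] := eqVneq `|A v - A u| 0.
  by rewrite D0 mul0r subr_ge0 ler_pM// ltW.
rewrite (linearB A) in V1; rewrite (linearB A) -[A u - A v]opprB in V2.
have E : f - A v = (f - A u) - (A v - A u) by rewrite opprB addrA subrK.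
rewrite {1}E (ipNr hip) (ipBl hip) (ipxx hip) in V2; move: V1 V2.
have := ler_norm_ip hip (f - A u) (A v - A u); rewrite [`|f - _|]distrC ler_norml => /andP[+ _].
have {}a0 : 0 < `|A u - f| by rewrite lt_neqAle eq_sym a0/=.
have {}D0 : 0 < `|A v - A u| by rewrite lt_neqAle eq_sym D0/=.
move: rr a0 D0; set a := `|A u - f|; set b := `|A v - f|; set D := `|A v - A u|.
set q := ip _ _ => ab a0 D0 qle V1 V2.
have ta : 0 < t * a by rewrite mulr_gt0.
have sb : t * a <= s * b by rewrite ler_pM// ltW.
have sb0 : 0 < s * b by apply: lt_le_trans sb.
have W1 := ler_wpM2l (ltW sb0) V1; have W2 := ler_wpM2l (ltW ta) V2.
have key : t * a * D ^+ 2 <= (t * a - s * b) * q by nra.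
have key2 : t * a * D ^+ 2 <= (s * b - t * a) * (a * D).
  have := ler_wpM2l (_ : 0 <= s * b - t * a) (_ : - q <= a * D).
  by rewrite subr_ge0 => /(_ sb) /(_ _)/(le_trans _); apply; nra.
rewrite -(ler_pM2r (mulr_gt0 a0 D0)); nra.
Qed.

End minimizers.

(** * Small and large parameters, and domination of the path *)

Section large_and_small_parameters.
Context {R : realType} {Y X H : normedModType R}.
Variables (ip : H -> H -> R) (pair : X -> Y -> R).
Variables (A : {linear X -> H}) (J : X -> \bar R) (f : H).
Hypothesis hip : is_inner_product ip.
Hypothesis hY : separable Y.
Hypothesis hX : is_dual_pairing pair.
Hypothesis hA : continuous A.
Hypothesis J_ge0 : forall u, (0 <= J u)%E.
Hypothesis J_convex : convex_functional J.
Hypothesis J_lsc : weak_star_lsc pair J.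
Hypothesis J_homog : abs_one_homogeneous J.
Hypothesis hf : forall u, A u = f -> J u <> 0%E.
Hypothesis norm_equiv : exists c C : R, [/\ 0 < c, 0 < C &
     forall u, nullset J u -> c * `|u| <= `|A u| /\ `|A u| <= C * `|u|].
Hypothesis poincare : exists C : R, 0 < C /\
     forall u, (`|u - null_proj A J (A u)|%:E <= C%:E * J u)%E.
Hypothesis A_weak : forall (u_ : nat -> X) (u : X),
     weak_star_cvg pair u_ u -> weak_cvg ip (fun k => A (u_ k)) (A u).

Let null_projP g : is_null_proj A J g (null_proj A J g).
Proof.
exact: (is_null_proj_null_proj hip hY hX hA J_ge0 J_lsc J_homog
          norm_equiv poincare A_weak).
Qed.

(** Normal equations of the least squares problem over the null space. *)
Lemma null_proj_ortho g v : nullset J v ->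
  ip (g - A (null_proj A J g)) (A v) = 0.
Proof.
move=> Jv; have [Jp hp] := null_projP g; set p := null_proj A J g in Jp hp *.
have [v0|v0] := eqVneq `|A v| 0.
  by rewrite (normr0_eq0 v0) (ip0r hip).
have {}v0 : 0 < `|A v| ^+ 2 by rewrite exprn_gt0// lt_neqAle eq_sym v0/=.
(* [a] is the minimizer of the quadratic polynomial [`|g - A (p + a *: v)| ^+ 2]. *)
set q := ip _ _; pose a := q / `|A v| ^+ 2.
have Ju : nullset J (p + a *: v).
  by apply: nullsetD => //; exact: nullsetZ.
have := hp _ Ju; rewrite -ler_sqr ?nnegrE// => h.
have e : A (p + a *: v) - g = - ((g - A p) - a *: A v).
  by rewrite linearD linearZ_LR/= !opprB [RHS]addrCA addrA.
rewrite e normrN (sqr_normB hip _ (a *: _)) (ipZr hip) -/q normrZ exprMn real_normK ?num_real// in h.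
rewrite [`|A p - g|]distrC in h.
have aq : a * `|A v| ^+ 2 = q by rewrite /a divfK// gt_eqF.
have : q ^+ 2 <= 0.
  rewrite -(pmulr_rle0 _ (_ : 0 < (`|A v| ^+ 2)^-1)) ?invr_gt0//.
  have -> : (`|A v| ^+ 2)^-1 * q ^+ 2 = a * q by rewrite /a; ring.
  have : a ^+ 2 * `|A v| ^+ 2 = a * q by rewrite expr2 -mulrA aq.
  by move: h; lra.
by rewrite le_eqVlt ltNge sqr_ge0 orbF sqrf_eq0 => /eqP.
Qed.

Lemma nullset_min_eq u : nullset J u ->
  `|A u - f| <= `|A (null_proj A J f) - f| -> A u = A (null_proj A J f).
Proof.
set p := null_proj A J f => Ju; rewrite -ler_sqr ?nnegrE// => h.
have Jup : nullset J (u - p).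
  apply: nullsetD => //.
  by rewrite /nullset/= homogN//; exact: (null_projP f).1.
have := null_proj_ortho f Jup; rewrite -/p => o.
have e : A u - f = A (u - p) - (f - A p) by rewrite linearB opprB addrA subrK.
have := sqr_normB hip (A (u - p)) (f - A p).
rewrite -e (ipC hip) o [`|f - A p|]distrC => sq.
apply/eqP; rewrite -subr_eq0 -linearB -normr_eq0 -sqrf_eq0 eq_le sqr_ge0 andbT.
lra.
Qed.

(** Replacing [u] by the projection of [A u] costs at most [K * C * J u] in the
    residual and saves [t * J u]. *)
Lemma minimizer_large : exists2 T : R, 0 < T & forall t u, T < t ->
  is_minimizer A J f t u -> A u = A (null_proj A J f).
Proof.
have [K K0 hK] := linear_norm_bound hA; have [C [C0 hC]] := poincare.
exists (K * C) => [|t u Tt um]; first by rewrite mulr_gt0.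
have t0 : 0 < t by rewrite (lt_trans _ Tt)// mulr_gt0.
have [j [j0 uj hu]] := minimizer_fin J_ge0 J_homog t0 um.
have [Jp hp] := null_projP f; have [Jp' _] := null_projP (A u).
have h1 := hp _ Jp'; have h2 := hu _ 0 Jp.
have h3 : `|u - null_proj A J (A u)| <= C * j.
  by have := hC u; rewrite uj -EFinM lee_fin.
have h4 : `|A (null_proj A J (A u)) - f| <= K * (C * j) + `|A u - f|.
  rewrite -[A (null_proj A J (A u))](subrK (A u)) -addrA.
  rewrite (le_trans (ler_normD _ _))// lerD2r distrC -linearB.
  by rewrite (le_trans (hK _))// ler_wpM2l// ltW.
have j00 : j = 0 by apply/eqP; rewrite eq_le j0 andbT; nra.
by apply: nullset_min_eq; [rewrite /nullset/= uj j00|move: h2; rewrite j00; lra].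
Qed.

(** Subtracting the component in the null space of [J] turns a competitor into an
    admissible element for the supremum defining [t_star_star]. *)
Lemma minimizer_gt_t_star_star t u : 0 < t ->
  (t_star_star ip A J f < t%:E)%E -> is_minimizer A J f t u ->
  A u = A (null_proj A J f).
Proof.
rewrite /t_star_star; set p := null_proj A J f => t0 tt um.
have [Jp hp] := null_projP f; rewrite -/p in Jp hp.
have e0 : 0 < `|f - A p|.
  rewrite normr_gt0 subr_eq0; apply/eqP => fp.
  by apply: (hf (esym fp)); exact: Jp.
have {}tt : (sup_ortho ip A J f < (t * `|f - A p|)%:E)%E.
  by rewrite EFinM -lte_pdivrMr//.
have [j [j0 uj hu]] := minimizer_fin J_ge0 J_homog t0 um.
have h2 := hu _ 0 Jp.
suff j00 : j = 0.
  by apply: nullset_min_eq; [rewrite /nullset/= uj j00|move: h2; rewrite j00; lra].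
apply/eqP; rewrite eq_le j0 andbT leNgt; apply/negP => {}j0.
have [Jp' _] := null_projP (A u).
set p' := null_proj A J (A u) in Jp'.
pose w := u - p'.
have Jw : J w = j%:E.
  by rewrite /w homogD_null// /nullset/= homogN.
have ow v : nullset J v -> ip (A w) (A v) = 0.
  by move=> Jv; rewrite /w linearB; exact: null_proj_ortho.
have adm : (ip f (A (j^-1 *: w)))%:E \in
    [set (ip f (A u))%:E | u in
      [set u | J u = 1%E /\ forall v, nullset J v -> ip (A u) (A v) = 0]].
  rewrite inE; exists (j^-1 *: w) => //=; split.
    by rewrite J_homog Jw -EFinM gtr0_norm ?invr_gt0// mulVf// gt_eqF.
  by move=> v Jv; rewrite linearZ_LR/= (ipZl hip) ow// mulr0.
have := le_lt_trans (ereal_sup_ubound (set_mem adm)) tt.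
rewrite lte_fin linearZ_LR/= (ipZr hip) mulrC ltr_pdivrMr// => fw.
have := ip_le hip (f - A u) (f - A p); rewrite [`|f - A u|]distrC.
have -> : ip (f - A u) (f - A p) = `|f - A p| ^+ 2 - ip f (A w).
  have -> : f - A u = (f - A p) + A p - A w - A p'.
    by rewrite /w linearB subrK opprB addrA addrAC addrK.
  rewrite !(ipBl hip) (ipDl hip) (ipxx hip).
  rewrite [ip (A p) _](ipC hip) [ip (A p') _](ipC hip) !null_proj_ortho//.
  by rewrite (ipBr hip) ow// (ipC hip _ f); ring.
rewrite [`|A p - f|]distrC in h2.
by move: h2 fw e0; set e := `|f - A p|; set r := `|A u - f|; set q := ip _ _; nra.
Qed.

(** Exact penalization: a source element of norm less than [1 / t] controls the
    gain in [J] by the residual. *)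
Lemma minimizer_lt_t_star t u : 0 < t -> t < t_star ip A J f ->
  is_minimizer A J f t u -> A u = f.
Proof.
rewrite /t_star; case: asboolP => [|_ t0 /(lt_trans t0)]; last by rewrite ltxx.
move=> [q0 sq0] t0 ts um; set E := [set `|q| | q in _] in ts.
have iE : has_inf E.
  by split; [exists `|q0|; exists q0|exists 0 => _ [q _ <-]].
have i0 : 0 < inf E by rewrite -invr_gt0 (lt_trans t0).
have ti : inf E < t^-1 by rewrite -[ltLHS]invrK ltf_pV2// posrE// invr_gt0.
have [|_ [q [v [Jv Av [_ _ qs]]] <-] hq] := @inf_adherent _ E (t^-1 - inf E) _ iE.
  by rewrite subr_gt0.
have {}hq : t * `|q| < 1.
  by rewrite mulrC -ltr_pdivlMr// div1r; move: hq; rewrite addrC subrK.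
have [j [j0 uj hu]] := minimizer_fin J_ge0 J_homog t0 um.
have [i i0' vi] := dom_fine J_ge0 Jv.
have := qs u; rewrite vi uj /adjoint linearB Av -EFinD lee_fin => h1.
have := hu _ _ vi; rewrite Av subrr normr0 add0r => h2.
have := ler_norm_ip hip q (A u - f); rewrite ler_norml => /andP[h3 _].
apply/eqP; rewrite -subr_eq0 -normr_eq0 eq_le normr_ge0 andbT.
by move: h1 h2 h3 hq (normr_ge0 (A u - f)); nra.
Qed.

(** Two minimizers with different images have different values of [J], so that
    the nonincreasing function [J] along a selection of minimizers jumps there. *)
Lemma ae_unique_image : {ae lebesgue_measure, forall t : R, 0 < t ->
  exists! g : H, exists u, is_minimizer A J f t u /\ A u = g}.
Proof.
have /choice[u hu] t : exists u, 0 < t -> is_minimizer A J f t u.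
  have [t0|t0] := ltP 0 t; last by exists 0.
  have [u hu] := exists_minimizer hip hY hX hA J_ge0 J_lsc J_homog
          norm_equiv poincare A_weak f t0.
  by exists u.
pose F t := - fine (J (u t)).
have cD := countable_jumps 0 F; set D := [set t | _] in cD.
exists D; split.
- exact: countable_measurable.
- exact: countable_lebesgue_measure0.
move=> t /= nt; apply: contrapT => Dt; apply: nt => t0.
exists (A (u t)); split; first by exists (u t); split=> //; exact: hu.
move=> _ [v [vm <-]]; apply: contrapT => uv; apply: Dt; split => //.
have um := hu _ t0.
have lev w j s : is_minimizer A J f t w -> J w = j%:E -> 0 < s -> s < t ->
    F s <= - j.
  move=> wm wj s0 st; have [i [_ ui _]] := minimizer_fin J_ge0 J_homog s0 (hu _ s0).
  rewrite /F ui lerN2.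
  by have [] := minimizers_mono J_ge0 J_homog s0 st (hu _ s0) wm ui wj.
have lev2 w j s : is_minimizer A J f t w -> J w = j%:E -> t < s -> - j <= F s.
  move=> wm wj ts; have s0 := lt_trans t0 ts.
  have [i [_ ui _]] := minimizer_fin J_ge0 J_homog s0 (hu _ s0).
  rewrite /F ui lerN2.
  by have [] := minimizers_mono J_ge0 J_homog t0 ts wm (hu _ s0) wj ui.
have [j [_ uj _]] := minimizer_fin J_ge0 J_homog t0 um.
have [i [_ vi _]] := minimizer_fin J_ge0 J_homog t0 vm.
have [ij|ij|ij] := ltgtP i j.
- exists (- j), (- i); split; first by rewrite ltrN2.
    by move=> s; exact: lev um uj.
  by move=> s; exact: lev2 vm vi.
- exists (- i), (- j); split; first by rewrite ltrN2.
    by move=> s; exact: lev vm vi.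
  by move=> s; exact: lev2 um uj.
- case: uv; apply: (minimizers_eq hip J_ge0 J_convex J_homog t0 um vm).
  by rewrite uj vi ij.
Qed.

Section path.
Variable u : R -> X.
Hypothesis hu : forall t, 0 < t -> is_minimizer A J f t (u t).

Lemma path_const_large : exists2 T : R, 0 < T &
  forall t s, T < t -> T < s -> A (u t) = A (u s).
Proof.
have [T T0 hT] := minimizer_large; exists T => // t s Tt Ts.
by rewrite (hT t) ?(hT s)//; apply: hu; exact: lt_trans T0 _.
Qed.

(** By [minimizers_dist] the nondecreasing function [tau / delta] dominates the
    path on the right of [delta]; freezing it at some [S] beyond which the path is
    constant makes it bounded. *)
Lemma dominated_path_gt delta : 0 < delta ->
  exists V : R -> R, [/\ {homo V : x y / x <= y},
    exists M, forall x, 0 <= V x <= M &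
    forall t s, delta < t -> t < s -> `|A (u s) - A (u t)| <= V s - V t].
Proof.
move=> d0; have [T T0 hT] := path_const_large.
pose tau t := t * `|A (u t) - f|.
pose S := Num.max delta T + 1.
have dS : delta < S by rewrite /S ltr_pwDr// le_max lexx.
have TS : T < S by rewrite /S ltr_pwDr// le_max lexx orbT.
have S0 := lt_trans d0 dS.
have dist t s : delta < t -> t < s ->
    `|A (u s) - A (u t)| <= (tau s - tau t) / delta.
  move=> dt ts; have t0 := lt_trans d0 dt; have s0 := lt_trans t0 ts.
  have h := minimizers_dist hip J_ge0 J_convex J_homog t0 ts (hu t0) (hu s0).
  have h0 : 0 <= tau s - tau t.
    by rewrite -(pmulr_lge0 _ (_ : 0 < t^-1)) ?invr_gt0// (le_trans _ h).
  by rewrite (le_trans h)// ler_wpM2l// lef_pV2 ?posrE// ltW.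
have tau0 t : 0 < t -> 0 <= tau t by move=> t0; rewrite mulr_ge0// ltW.
have mono t s : delta < t -> t <= s -> tau t <= tau s.
  move=> dt; rewrite le_eqVlt => /predU1P[->//|ts].
  have := le_trans (normr_ge0 _) (dist _ _ dt ts).
  by rewrite pmulr_lge0 ?invr_gt0// subr_ge0.
pose V t := if t <= delta then 0 else tau (Num.min t S) / delta.
have minS t : delta < t -> delta < Num.min t S by move=> dt; rewrite lt_min dt.
have V0 t : 0 <= V t.
  rewrite /V; case: (leP t) => // dt; rewrite divr_ge0 ?(ltW d0)// tau0//.
  by rewrite (lt_trans d0)// minS.
have Vm : {homo V : x y / x <= y}.
  move=> x y xy; have := V0 y; rewrite /V; case: (leP x) => // dx.
  case: (leP y) => [yx|_ _]; first by have := lt_le_trans dx xy; rewrite ltNge yx.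
  rewrite ler_wpM2r ?invr_ge0 ?(ltW d0)//; apply: mono; first exact: minS.
  by rewrite le_min !ge_min xy lexx orbT.
exists V; split => //.
  exists (tau S / delta) => x; rewrite V0 /V; case: (leP x) => /= dx.
    by rewrite divr_ge0 ?tau0// ltW.
  rewrite ler_wpM2r ?invr_ge0 ?(ltW d0)//; apply: mono; first exact: minS.
  by rewrite ge_min lexx orbT.
move=> t s dt ts; have ds := lt_trans dt ts.
have VE x : delta < x -> V x = tau (Num.min x S) / delta.
  by move=> dx; rewrite /V leNgt dx.
rewrite !VE// -mulrBl.
have gmin x : A (u x) = A (u (Num.min x S)).
  by have [xS|Sx] := leP x S => //; apply: hT => //; rewrite (lt_trans TS).
rewrite (gmin s) (gmin t).
have [->|ne] := eqVneq (Num.min t S) (Num.min s S).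
  by rewrite !subrr normr0 mul0r.
apply: dist; first exact: minS.
by rewrite lt_neqAle ne/= le_min !ge_min (ltW ts) lexx orbT.
Qed.

(** The path is constant on the left of [t_star], so the increments can be
    measured from [t_star / 2] onwards. *)
Lemma dominated_path_gt0 : 0 < t_star ip A J f ->
  exists V : R -> R, [/\ {homo V : x y / x <= y},
    exists M, forall x, 0 <= V x <= M &
    forall t s, 0 < t -> t < s -> `|A (u s) - A (u t)| <= V s - V t].
Proof.
set ts := t_star ip A J f => ts0.
have d0 : 0 < ts / 2 by rewrite divr_gt0.
have [V [Vm [M VM] hV]] := dominated_path_gt d0.
pose W x := if x <= ts / 2 then 0 else V x.
have W0 x : 0 <= W x by rewrite /W; case: (leP x) => // _; case/andP: (VM x).
have Wm : {homo W : x y / x <= y}.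
  move=> x y xy; have := W0 y; rewrite /W; case: (leP x) => // dx.
  by case: (leP y) => [yx|_ _]; [have := lt_le_trans dx xy; rewrite ltNge yx|exact: Vm].
have gf t : 0 < t -> t < ts -> A (u t) = f.
  by move=> t0 tts; apply: minimizer_lt_t_star (hu t0).
exists W; split => //.
  exists M => x; rewrite W0 /W; case: (leP x) => _; last by case/andP: (VM x).
  by case/andP: (VM 0) => /le_trans h /h.
move=> t s t0 tls; have s0 := lt_trans t0 tls.
have [dt|td] := ltP (ts / 2) t.
  by have h := hV _ _ dt tls; rewrite /W (leNgt s) (leNgt t) dt (lt_trans dt tls).
have tts : t < ts by lra.
rewrite (gf t)// {2}/W td subr0.
have [sts|tss] := ltP s ts; first by rewrite gf// subrr normr0.
have m1 : ts / 2 < ts * (3 / 4) by lra.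
have m2 : ts * (3 / 4) < ts by lra.
rewrite -(gf (ts * (3 / 4))) ?(lt_trans d0)//.
have ss : ts * (3 / 4) < s by lra.
rewrite (le_trans (hV _ _ m1 ss))// /W (leNgt s) (lt_trans m1 ss)/=.
by rewrite gerBl; case/andP: (VM (ts * (3 / 4))).
Qed.

End path.
End large_and_small_parameters.

(** * Finite Stieltjes measures *)

(** The proof of finiteness is a parameter of this alias so that the structure of
    finite measure can be attached to it. *)
Definition finite_copy d (T : measurableType d) (R : realType)
  (mu : {measure set T -> \bar R}) (h : fin_num_fun mu) : set T -> \bar R := mu.

Section finite_copy.
Context d (T : measurableType d) (R : realType).
Variables (mu : {measure set T -> \bar R}) (h : fin_num_fun mu).

HB.instance Definition _ := Measure.on (finite_copy h).

HB.instance Definition _ :=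
  @Measure_isFinite.Build _ _ _ (finite_copy h) h.

End finite_copy.

Section stieltjes.
Context {R : realType}.

(** The half-open intervals form a generating semiring exhausting the line. *)
Lemma eq_measure_ocitv (p q : {measure set R -> \bar R}) :
  (forall a b, a <= b -> (p `]a, b]%classic < +oo)%E) ->
  (forall a b, a <= b -> p `]a, b]%classic = q `]a, b]%classic) ->
  forall B, measurable B -> p B = q B.
Proof.
move=> poo pq B mB.
pose g (n : nat) : set R := `](- n%:R), n%:R]%classic.
apply: (measure_unique (R.-ocitv.-measurable) g) => //.
- by move=> X Z mX mZ; exact: (@measurableI _ (ocitv_type R)).
- by move=> n; exact: is_ocitv.
- exact: (bigcup_itvT false false).
- move=> _ [[a b] _ <-]; have [ab|ba] := leP a b; first exact: pq.
  by rewrite set_itv_ge ?measure0// bnd_simp -leNgt ltW.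
- by move=> n; apply: poo; rewrite (@le_trans _ _ 0)// oppr_le0.
Qed.


Variables (F : R -> R) (M : R).
Hypothesis Fnd : {homo F : x y / x <= y}.
Hypothesis Frc : forall x, F @ at_right x --> F x.
Hypothesis FM : forall x, `|F x| <= M.

Lemma exists_stieltjes : exists p : {finite_measure set R -> \bar R},
  forall a b, a <= b -> p `]a, b]%classic = (F b - F a)%:E.
Proof.
pose C : cumulative R R := HB.pack F (isCumulative.Build R _ R F Fnd Frc).
pose m0 : {measure set (measurableTypeR R) -> \bar R} :=
  lebesgue_stieltjes_measure C.
pose m : {measure set R -> \bar R} := HB.pack (m0 : set R -> \bar R)
  (isMeasure.Build _ R R m0 (measure0 m0) (measure_ge0 m0)
    (@measure_semi_sigma_additive _ _ _ m0)).
have mE a b : a <= b -> m `]a, b]%classic = (F b - F a)%:E.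
  move=> ab; have -> : m `]a, b]%classic = wlength C `]a, b]%classic.
    apply: (@measurable_mu_extE _ _ _ (wlength C)); exact: is_ocitv.
  by rewrite wlength_itv_bnd.
have mT : (m setT < +oo)%E.
  have : (m \o (fun n : nat => `](- n%:R), n%:R]%classic)) @ \oo --> m setT.
    rewrite -(bigcup_itvT false false).
    apply: nondecreasing_cvg_mu => //; first exact: bigcup_measurable.
    by move=> *; apply/subsetPset/subset_itv; rewrite leBSide/= ?lerN2 ler_nat.
  move=> cm; apply: (@le_lt_trans _ _ (M + M)%:E); last exact: ltry.
  apply: (cvge_to_le cm); near=> n => /=.
  rewrite mE ?lee_fin; last by rewrite (@le_trans _ _ 0)// ?oppr_le0.
  have := FM n%:R; have := FM (- n%:R); rewrite !ler_norml; lra.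
have fm : fin_num_fun m.
  move=> U mU; rewrite ge0_fin_numE// (le_lt_trans _ mT)// le_measure ?inE//.
by exists (finite_copy fm); exact: mE.
Unshelve. all: by end_near. Qed.

End stieltjes.

(** * Vector measures from their scalar marginals *)

(** The bounded sequence [w] is nondecreasing, hence convergent, and transfers its
    Cauchy property to [x_]. *)
Lemma dominated_cvg {R : realType} {H : completeNormedModType R}
    (x_ : nat -> H) (w : nat -> R) (M : R) :
  (forall n m, (n <= m)%N -> `|x_ m - x_ n| <= w m - w n) ->
  (forall n, w n <= M) -> exists x : H, x_ @ \oo --> x.
Proof.
move=> xw wM.
have wnd : nondecreasing_seq w.
  by move=> n m nm; rewrite -subr_ge0 (le_trans _ (xw _ _ nm)).
have cw : cvgn w.
  by apply: nondecreasing_is_cvgn => //; exists M => _ [n _ <-].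
suff : cvg (x_ @ \oo) by move=> /cvg_ex.
apply: cauchy_cvg; apply: cauchy_exP => e e0.
have /cvgrPdist_lt/(_ _ e0)[N _ hN] := cw.
exists (x_ N); exists N => // n /= Nn.
rewrite -ball_normE /= distrC (le_lt_trans (xw _ _ Nn))//.
have h1 := nondecreasing_cvgn_le wnd cw n.
have := hN N (leqnn N); rewrite ger0_norm; first lra.
by rewrite subr_ge0 nondecreasing_cvgn_le.
Qed.

(** A family of signed measures [p h - m h], indexed by [h] in a Hilbert space and
    dominated by [`|h|] times one finite measure [nu], comes from a vector measure
    as soon as it does so on intervals: the representable sets form a Dynkin
    class, limits being taken by completeness thanks to [nu]. *)
Section vector_measure_of_marginals.
Context {R : realType} {H : completeNormedModType R}.
Variable ip : H -> H -> R.
Hypothesis hip : is_inner_product ip.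
Variables (nu : {finite_measure set R -> \bar R}).
Variables (p m : H -> {finite_measure set R -> \bar R}).
Hypothesis pm : forall h B, measurable B ->
  (p h B + m h B = `|h|%:E * nu B)%E.

Let nv B := fine (nu B).
Let sg h B := fine (p h B) - fine (m h B).
Definition represents (B : set R) (x : H) := forall h, ip x h = sg h B.

Hypothesis rep_itv : forall a b, a <= b ->
  exists x, represents `]a, b]%classic x.

Let nvE B : measurable B -> nu B = (nv B)%:E.
Proof. by move=> mB; rewrite fineK// fin_num_measure. Qed.

Let fpm h B : measurable B -> fine (p h B) + fine (m h B) = `|h| * nv B.
Proof.
move=> mB; rewrite -fineD ?fin_num_measure// pm//.
by rewrite nvE.
Qed.

Let sg_le h B : measurable B -> sg h B <= `|h| * nv B.
Proof.
move=> mB; rewrite -fpm// /sg; have : 0 <= fine (m h B) by rewrite fine_ge0.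
lra.
Qed.

(** Test the representation against the representing vector itself. *)
Lemma represents_norm_le B x : measurable B -> represents B x -> `|x| <= nv B.
Proof.
move=> mB hx; have := sg_le x mB; rewrite -hx (ipxx hip) expr2.
have [->|x0] := eqVneq `|x| 0; first by rewrite fine_ge0.
by rewrite ler_pM2l// lt_neqAle eq_sym x0/=.
Qed.

Let sgU h B C : measurable B -> measurable C -> B `&` C = set0 ->
  sg h (B `|` C) = sg h B + sg h C.
Proof.
move=> mB mC BC; rewrite /sg !measureU// !fineD ?fin_num_measure//; lra.
Qed.

Let nvU B C : measurable B -> measurable C -> B `&` C = set0 ->
  nv (B `|` C) = nv B + nv C.
Proof. by move=> mB mC BC; rewrite /nv !measureU// !fineD ?fin_num_measure. Qed.

Lemma representsU B C x y : measurable B -> measurable C -> B `&` C = set0 ->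
  represents B x -> represents C y -> represents (B `|` C) (x + y).
Proof. by move=> mB mC BC hx hy h; rewrite (ipDl hip) hx hy sgU. Qed.

Let DU (B C : set R) : B `<=` C -> C = B `|` (C `\` B).
Proof. by move=> BC; rewrite setDUK. Qed.

Lemma representsD B C x y : measurable B -> measurable C -> B `<=` C ->
  represents B x -> represents C y -> represents (C `\` B) (y - x).
Proof.
move=> mB mC BC hx hy h; rewrite (ipBl hip) hx hy {1}(DU BC) sgU//; last 2 first.
- exact: measurableD.
- by rewrite setDE setICA setICr setI0.
- by rewrite addrC addKr.
Qed.

Let nvD B C : measurable B -> measurable C -> B `<=` C ->
  nv (C `\` B) = nv C - nv B.
Proof.
move=> mB mC BC; rewrite {2}(DU BC) nvU//; last 2 first.
- exact: measurableD.
- by rewrite setDE setICA setICr setI0.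
- by rewrite addrC addKr.
Qed.

Let fine_cvg_mu (q : {finite_measure set R -> \bar R}) (F : nat -> set R) :
  (forall n, measurable (F n)) -> nondecreasing_seq F ->
  fine (q (F n)) @[n --> \oo] --> fine (q (\bigcup_n F n)).
Proof.
move=> mF ndF; have mU : measurable (\bigcup_n F n) by exact: bigcup_measurable.
apply: (@fine_cvg _ _ _ _ (q \o F)); rewrite fineK ?fin_num_measure//.
exact: nondecreasing_cvg_mu.
Qed.

(** The representing vectors are a Cauchy sequence because their increments are
    bounded by the [nu]-mass of the increments of the sets. *)
Lemma represents_ndunion (F : nat -> set R) : (forall n, measurable (F n)) ->
  nondecreasing_seq F -> (forall n, exists x, represents (F n) x) ->
  exists x, represents (\bigcup_n F n) x.
Proof.
move=> mF ndF /choice[x_ hx].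
have mU : measurable (\bigcup_n F n) by exact: bigcup_measurable.
have sub n k : (n <= k)%N -> F n `<=` F k by move=> /ndF/subsetPset.
have [||x cx] := @dominated_cvg _ _ x_ (fun n => nv (F n)) (nv setT).
- move=> n k nk; rewrite -nvD//; last exact: sub.
  apply: represents_norm_le; first exact: measurableD.
  by apply: representsD => //; exact: sub.
- move=> n; rewrite fine_le ?fin_num_measure//.
  by rewrite le_measure ?inE.
exists x => h; apply: (@cvg_unique _ _ ((fun n => ip (x_ n) h) @ \oo)).
- exact: norm_hausdorff.
- exact: cvg_ipl.
have -> : (fun n => ip (x_ n) h) = (fun n => sg h (F n)).
  by apply/funext => n; exact: hx.
by apply: cvgB; exact: fine_cvg_mu.
Qed.

Let trivIset_partial (F : nat -> set R) n : trivIset setT F ->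
  \big[setU/set0]_(k < n) F k `&` F n = set0.
Proof.
move=> tF; apply: (@trivIset_bigsetUI _ xpredT) => // i j _ _; exact: tF.
Qed.

Lemma represents_bigsetU (F : nat -> set R) (x_ : nat -> H) n :
  (forall k, measurable (F k)) -> trivIset setT F ->
  (forall k, represents (F k) (x_ k)) ->
  represents (\big[setU/set0]_(k < n) F k) (\sum_(k < n) x_ k).
Proof.
move=> mF tF hx; elim: n => [|n IH].
  by rewrite !big_ord0 => h; rewrite (ip0l hip) /sg !measure0 subrr.
rewrite !big_ord_recr /=; apply: representsU => //.
  exact: bigsetU_measurable.
exact: trivIset_partial.
Qed.

Lemma represents_setT : exists x, represents setT x.
Proof.
rewrite -(bigcup_itvT false false); apply: represents_ndunion => //.
  by move=> *; apply/subsetPset/subset_itv; rewrite leBSide/= ?lerN2 ler_nat.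
by move=> n; apply: rep_itv; rewrite (@le_trans _ _ 0)// oppr_le0.
Qed.

(** Dynkin induction; disjoint unions are increasing limits of finite ones. *)
Lemma represents_ex B : measurable B -> exists x, represents B x.
Proof.
move=> mB; apply: (@dynkin_induction _ R R.-ocitv.-measurable
  (fun B => exists x, represents B x) _ _ _ _ _ _ B mB) => //.
- by move=> X Z mX mZ; exact: (@measurableI _ (ocitv_type R)).
- exact: represents_setT.
- move=> _ [[a b] _ <-] /=; have [ab|ba] := leP a b; first exact: rep_itv.
  exists 0 => h; rewrite set_itv_ge ?bnd_simp -?leNgt ?ltW//.
  by rewrite (ip0l hip) /sg !measure0 subrr.
- move=> C mC [x hx]; have [y hy] := represents_setT.
  by exists (y - x); rewrite -setTD; exact: representsD.
- move=> F mF tF /choice[x_ hx]; rewrite -bigcup_bigsetU_bigcup.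
  apply: represents_ndunion.
  + by move=> n; exact: bigsetU_measurable.
  + by move=> a b ab; apply/subsetPset/subset_bigsetU.
  + by move=> n; exists (\sum_(k < n.+1) x_ k); exact: represents_bigsetU.
Qed.

(** Norm-countable additivity and finiteness of the variation both come from the
    domination by [nu]. *)
Lemma vector_measure_ex : exists mu : set R -> H,
  [/\ is_vector_measure mu, (vector_variation mu < +oo)%E,
      forall B, measurable B -> represents B (mu B)
    & forall B, measurable B -> (`|mu B|%:E <= nu B)%E].
Proof.
pose mu B := xget 0 [set x | represents B x].
have muP B : measurable B -> represents B (mu B).
  by move=> /represents_ex[x hx]; apply: (@xgetPex _ 0 [set x | represents B x]); exists x.
have mu_le B : measurable B -> `|mu B| <= nv B.
  by move=> mB; apply: represents_norm_le => //; exact: muP.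
have mu_uniq B x : measurable B -> represents B x -> mu B = x.
  by move=> mB hx; apply: (ip_inj hip) => h; rewrite hx muP.
exists mu; split => //.
- split.
    by apply: mu_uniq => // h; rewrite (ip0l hip) /sg !measure0 subrr.
  move=> F mF tF; have mU : measurable (\bigcup_n F n) by exact: bigcup_measurable.
  pose S n := \big[setU/set0]_(k < n) F k.
  have mS n : measurable (S n) by exact: bigsetU_measurable.
  have SU n : S n `<=` \bigcup_n F n by exact: bigsetU_bigcup.
  have hS n : represents (S n) (\sum_(k < n) mu (F k)).
    by apply: (represents_bigsetU _ (x_ := mu \o F)) => // k; exact: muP.
  have cn : nv (\bigcup_n F n) - nv (S n) @[n --> \oo] --> (0 : R).
    rewrite -(subrr (nv (\bigcup_n F n))); apply: cvgB; first exact: cvg_cst.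
    rewrite -(cvg_shiftS (nv \o S)) -bigcup_bigsetU_bigcup.
    apply: fine_cvg_mu => [n|a b ab]; first exact: mS.
    by apply/subsetPset/subset_bigsetU.
  apply/cvgrPdist_le => e e0; move/cvgrPdist_le : cn => /(_ _ e0).
  apply: filterS => n; rewrite sub0r normrN; apply: le_trans.
  apply: (@le_trans _ _ (nv (\bigcup_n F n `\` S n))).
    apply: represents_norm_le; first exact: measurableD.
    by apply: representsD => //; exact: muP.
  by rewrite nvD// ler_norm.
- apply: (@le_lt_trans _ _ (nv setT)%:E); last exact: ltry.
  apply: ub_ereal_sup => _ [n [F [mF tF ->]]]; rewrite lee_fin.
  apply: (@le_trans _ _ (nv (\big[setU/set0]_(k < n) F k))); last first.
    have mS := @bigsetU_measurable _ R _ (index_enum 'I_n) xpredT F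
      (fun i _ => mF i).
    by apply: fine_le; rewrite ?fin_num_measure// le_measure ?inE.
  elim: n => [|n IH]; first by rewrite !big_ord0 fine_ge0.
  rewrite !big_ord_recr /= nvU//; last 2 first.
  + exact: bigsetU_measurable.
  + exact: trivIset_partial.
  by rewrite lerD// mu_le.
- by move=> B mB; rewrite nvE// lee_fin mu_le.
Qed.

End vector_measure_of_marginals.

(** * Integration by parts *)

Section by_parts.
Context {R : realType}.
Variables (F : R -> R) (M : R) (p : {finite_measure set R -> \bar R}).
Hypothesis Fnd : {homo F : x y / x <= y}.
Hypothesis FM : forall x, `|F x| <= M.
Hypothesis pF : forall a b, a <= b -> p `]a, b]%classic = (F b - F a)%:E.

(** The constant [L] is the limit of [F] at infinity; it drops out of the
    integration by parts because [derive1 phi] has integral [0]. *)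
Lemma stieltjes_ray : exists L, forall s, p `]s, +oo[%classic = (L - F s)%:E.
Proof.
have pf (B : set R) : measurable B -> p B = (fine (p B))%:E.
  by move=> mB; rewrite fineK// fin_num_measure.
have split a b : a <= b ->
    fine (p `]a, +oo[%classic) = F b - F a + fine (p `]b, +oo[%classic).
  move=> ab; have -> : `]a, +oo[%classic = `]a, b] `|` `]b, +oo[.
    apply/seteqP; split=> x /=; rewrite !in_itv/= ?andbT.
      by move=> ax; have [xb|bx] := leP x b; [left; rewrite ax|right].
    by move=> [/andP[]//|]; exact: le_lt_trans.
  rewrite measureU//=; last first.
    apply/seteqP; split=> x //=; rewrite !in_itv/= andbT => -[/andP[_ xb]].
    by rewrite ltNge xb.
  by rewrite fineD ?fin_num_measure// pF.
exists (fine (p `]0, +oo[%classic) + F 0) => s; rewrite pf//; congr (_%:E).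
by have [s0|/ltW s0] := leP s 0; [have := split _ _ s0|have := split _ _ s0]; lra.
Qed.

Variables (phi : R -> R) (a b : R).
Hypothesis ab : a < b.
Hypothesis dphi : forall x, derivable phi x 1.
Hypothesis cphi : continuous (derive1 phi).
Hypothesis phi0 : forall x, ~ (a < x < b) -> phi x = 0.
Hypothesis dphi0 : forall x, ~ (a < x < b) -> derive1 phi x = 0.

Let ccphi : continuous phi.
Proof. by move=> x; apply: differentiable_continuous; exact/derivable1_diffP. Qed.

Let mphi : measurable_fun setT (derive1 phi).
Proof. exact: continuous_measurable_fun. Qed.

Lemma integral_derive_lt t :
  (\int[lebesgue_measure]_s (if s < t then derive1 phi s else 0)%:E = (phi t)%:E)%E.
Proof.
have [at_|ta] := ltP a t; last first.
  rewrite phi0; last by rewrite ltNge ta.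
  rewrite (eq_integral (cst 0%E)) ?integral0// => s _ /=.
  case: ifPn => // st; rewrite dphi0//.
  by rewrite ltNge (ltW (lt_le_trans st ta)).
transitivity (\int[lebesgue_measure]_(s in `[a, t[) (derive1 phi s)%:E)%E.
  rewrite [RHS]integral_mkcond; apply: eq_integral => s _.
  rewrite patchE; case: ifPn => st; case: ifPn => //.
  - by rewrite notin_setE /= in_itv/= st andbT => /negP; rewrite -ltNge => sa;
       rewrite dphi0// ltNge ltW.
  - by rewrite inE /= in_itv/= (negbTE st) andbF.
rewrite integral_itv_bndo_bndc; last first.
  by apply/measurable_EFinP; exact: measurable_funS mphi.
rewrite (continuous_FTC2 at_ (F := phi)).
- by rewrite (phi0 (x := a)) ?ltxx// sube0.
- by apply: continuous_subspaceT; exact: cphi.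
- split; first by move=> x _; exact: dphi.
  + by apply: cvg_at_right_filter; exact: ccphi.
  + by apply: cvg_at_left_filter; exact: ccphi.
- by [].
Qed.

Lemma integral_derive0 : \int[lebesgue_measure]_s (derive1 phi s) = 0.
Proof.
rewrite /Rintegral -[RHS]/(fine 0%:E) -(phi0 (x := b)) ?ltxx ?andbF//.
rewrite -integral_derive_lt; congr fine; apply: eq_integral => s _.
case: ifPn => // sb; rewrite dphi0// => /andP[_ sb'].
by rewrite sb' in sb.
Qed.

Lemma integrable_derive_mul (G : R -> R) (N : R) : measurable_fun setT G ->
  (forall x, `|G x| <= N) ->
  lebesgue_measure.-integrable setT (fun s => (derive1 phi s * G s)%:E).
Proof.
move=> mG GN.
have [K [_ hK]] : bounded_set (derive1 phi @` `[a, b]).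
  apply: compact_bounded; apply: continuous_compact; last exact: segment_compact.
  by apply: continuous_subspaceT; exact: cphi.
have -> : (fun s => (derive1 phi s * G s)%:E) =
    ((EFin \o (fun s => derive1 phi s * G s)) \_ `[a, b]).
  apply/funext => s; rewrite patchE; case: ifPn => //=.
  rewrite notin_setE /= in_itv/= => sab; rewrite dphi0 ?mul0r//.
  by move=> /andP[/ltW h1 /ltW h2]; apply: sab; rewrite h1 h2.
apply: (proj1 (@integrable_mkcond _ (measurableTypeR R) R lebesgue_measure
  `[a, b]%classic (EFin \o (fun s : R => derive1 phi s * G s)) _)) => //.
apply: (@measurable_bounded_integrable _ (measurableTypeR R) R lebesgue_measure
  (fun s : R => derive1 phi s * G s) `[a, b]%classic) => //.
- have h : (lebesgue_measure (`[a, b]%classic : set R) < +oo)%E.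
    by rewrite lebesgue_measure_itv /= lte_fin ab -EFinD ltry.
  exact: h.
- apply: measurable_funM; first exact: measurable_funS mphi.
  exact: measurable_funS mG.
exists ((`|K| + 1) * N); split; first exact: num_real.
move=> z hz x /= xab; rewrite (le_trans _ (ltW hz))// normrM ler_pM//.
by apply: (hK (`|K| + 1)); [rewrite ltr_pwDr// ler_norm|exists x].
Qed.

(** Write [phi t] as the integral of [derive1 phi] over [s < t], exchange the
    integrals by Fubini, and evaluate the mass of the ray on the right of [s]. *)
Lemma stieltjes_by_parts :
  \int[p]_t phi t = - \int[lebesgue_measure]_s (derive1 phi s * F s).
Proof.
have [L hL] := stieltjes_ray.
have mF : measurable_fun setT F by exact: nondecreasing_measurable.
pose f (z : measurableTypeR R * R) := (if z.1 < z.2 then derive1 phi z.1 else 0)%:E.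
have mf : measurable_fun setT f.
  apply/measurable_EFinP; apply: measurable_fun_ifT => //.
    by apply: measurable_fun_ltr; [exact: measurable_fst|exact: measurable_snd].
  by apply: measurableT_comp; [exact: mphi|exact: measurable_fst].
have inner s : (\int[p]_t f (s, t) = (derive1 phi s * (L - F s))%:E)%E.
  rewrite /f /= EFinM -hL -integral_cst// [RHS]integral_mkcond.
  apply: eq_integral => t _; rewrite patchE; case: ifPn => st; case: ifPn => //.
    by rewrite notin_setE /= in_itv/= st.
  by rewrite inE /= in_itv/= andbT (negbTE st).
have LF x : `|L - F x| <= `|L| + M.
  by rewrite (le_trans (ler_normB _ _))// lerD2l.
have mLF : measurable_fun setT (fun x => L - F x) by exact: measurable_funB.
have LF0 x : 0 <= L - F x by rewrite -lee_fin -hL.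
have iLF := integrable_derive_mul mLF LF.
have intf : (lebesgue_measure \x p)%E.-integrable setT f.
  apply/integrable12ltyP => //.
  have [_ +] := integrableP _ _ _ iLF; congr (_ < _)%E.
  apply: eq_integral => s _; rewrite /= normrM (ger0_norm (LF0 s)) EFinM -hL.
  rewrite -integral_cst// integral_mkcond; apply: eq_integral => t _.
  rewrite /f /= patchE mem_setE in_itv/= andbT.
  by case: ifP; rewrite ?normr0.
have fub := @Fubini _ _ (measurableTypeR R) R R lebesgue_measure p f intf.
have d0 := integral_derive0.
have i1 : lebesgue_measure.-integrable setT (fun s => (derive1 phi s)%:E).
  have := @integrable_derive_mul (cst 1) 1 _ _.
  under eq_fun do rewrite mulr1; apply => // x; rewrite normr1//.
have iF := integrable_derive_mul mF FM.
have e1 : \int[p]_t phi t =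
    \int[lebesgue_measure]_s (derive1 phi s * L - derive1 phi s * F s).
  rewrite /Rintegral; congr fine; transitivity (\int[p]_t
      \int[lebesgue_measure]_s f (s, t))%E.
    by apply: eq_integral => t _; rewrite -integral_derive_lt.
  rewrite -fub; apply: eq_integral => s _; rewrite inner.
  by rewrite mulrBr.
rewrite e1 RintegralB//; last first.
  have := @integrable_derive_mul (cst L) `|L| _ _.
  by apply => // x.
by rewrite RintegralZr// d0 mul0r sub0r.
Qed.

End by_parts.

(** * Derivatives of dominated paths *)

Section vector_stieltjes.
Context {R : realType} {H : completeNormedModType R}.
Variable ip : H -> H -> R.
Hypothesis hip : is_inner_product ip.
Variables (G : R -> H) (W : R -> R) (M : R).
Hypothesis GW : forall t s, t <= s -> `|G s - G t| <= W s - W t.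
Hypothesis Wrc : forall x, W @ at_right x --> W x.
Hypothesis WM : forall x, `|W x| <= M.

(** The difference of these two nondecreasing functions is [ip (G t) h] and their
    sum is [`|h| * W t]: a Jordan-type decomposition of [ip (G _) h] that [W]
    dominates uniformly on bounded sets of [h]. *)
Definition upper_marginal h t := (`|h| * W t + ip (G t) h) / 2.
Definition lower_marginal h t := (`|h| * W t - ip (G t) h) / 2.

Let Wnd : {homo W : x y / x <= y}.
Proof. by move=> x y /GW/(le_trans (normr_ge0 _)); rewrite subr_ge0. Qed.

Let Grc x : G @ at_right x --> G x.
Proof.
apply/cvgrPdist_le => e e0; have /cvgrPdist_le/(_ _ e0) := @Wrc x.
apply: filter_app; near=> s.
have xs : x <= s by apply/ltW; near: s; exact: nbhs_right_gt.
rewrite distrC [`|G x - _|]distrC ger0_norm ?subr_ge0 ?Wnd//.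
exact/le_trans/GW.
Unshelve. all: by end_near. Qed.

Let GM x : `|G x| <= `|G 0| + 2 * M.
Proof.
rewrite -[G x](subrK (G 0)) addrC (le_trans (ler_normD _ _))// lerD2l.
have := WM x; have := WM 0; rewrite !ler_norml => h1 h2.
have [x0|/ltW x0] := leP 0 x; first by apply: (le_trans (GW x0)); lra.
by rewrite distrC; apply: (le_trans (GW x0)); lra.
Qed.

Let ipGW h t s : t <= s -> `|ip (G s) h - ip (G t) h| <= `|h| * (W s - W t).
Proof.
move=> ts; rewrite -(ipBl hip) (le_trans (ler_norm_ip hip _ _))// mulrC.
by rewrite ler_wpM2l// GW.
Qed.

Lemma upper_marginal_nd h : {homo upper_marginal h : x y / x <= y}.
Proof.
move=> x y /(ipGW h); rewrite ler_norml /upper_marginal => /andP[+ _]; lra.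
Qed.

Lemma lower_marginal_nd h : {homo lower_marginal h : x y / x <= y}.
Proof.
move=> x y /(ipGW h); rewrite ler_norml /lower_marginal => /andP[_ +]; lra.
Qed.

Lemma marginal_bound h : exists K, forall x,
  `|upper_marginal h x| <= K /\ `|lower_marginal h x| <= K.
Proof.
exists (`|h| * M + (`|G 0| + 2 * M) * `|h|) => x.
have h1 : `| `|h| * W x| <= `|h| * M by rewrite normrM normr_id ler_wpM2l.
have h2 : `|ip (G x) h| <= (`|G 0| + 2 * M) * `|h|.
  by rewrite (le_trans (ler_norm_ip hip _ _))// ler_wpM2r.
rewrite /upper_marginal /lower_marginal !normrM.
rewrite (ger0_norm (_ : 0 <= 2^-1)) ?invr_ge0//.
have := ler_normD (`|h| * W x) (ip (G x) h).
have := ler_normB (`|h| * W x) (ip (G x) h).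
have := normr_ge0 (`|h| * W x + ip (G x) h).
have := normr_ge0 (`|h| * W x - ip (G x) h).
by split; lra.
Qed.

Let ipG_rc h x : (ip (G t) h) @[t --> at_right x] --> ip (G x) h.
Proof. exact: cvg_ipl. Qed.

(** The signed measures of the functions [ip (G _) h] are marginals of one vector
    measure, the vector of [`]a, b]] being [G b - G a]. *)
Lemma vector_stieltjes_ex : exists (mu : set R -> H)
    (nu : {finite_measure set R -> \bar R})
    (p m : H -> {finite_measure set R -> \bar R}),
  [/\ is_vector_measure mu /\ (vector_variation mu < +oo)%E,
      forall B, measurable B -> (`|mu B|%:E <= nu B)%E,
      forall h B, measurable B -> (ip (mu B) h)%:E = (p h B - m h B)%E,
      forall a b, a <= b -> nu `]a, b]%classic = (W b - W a)%:E
    & forall h a b, a <= b ->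
        p h `]a, b]%classic = (upper_marginal h b - upper_marginal h a)%:E /\
        m h `]a, b]%classic = (lower_marginal h b - lower_marginal h a)%:E].
Proof.
have [nu nuE] := exists_stieltjes Wnd Wrc WM.
have /choice[p pE] h : exists p : {finite_measure set R -> \bar R},
    forall a b, a <= b ->
    p `]a, b]%classic = (upper_marginal h b - upper_marginal h a)%:E.
  have [K hK] := marginal_bound h.
  apply: (exists_stieltjes (@upper_marginal_nd h) _ (fun x => (hK x).1)) => x.
  by apply: cvgMl; apply: cvgD; [apply: cvgMr; exact: Wrc|exact: ipG_rc].
have /choice[m mE] h : exists m : {finite_measure set R -> \bar R},
    forall a b, a <= b ->
    m `]a, b]%classic = (lower_marginal h b - lower_marginal h a)%:E.
  have [K hK] := marginal_bound h.
  apply: (exists_stieltjes (@lower_marginal_nd h) _ (fun x => (hK x).2)) => x.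
  by apply: cvgMl; apply: cvgB; [apply: cvgMr; exact: Wrc|exact: ipG_rc].
have pm h B : measurable B -> (p h B + m h B = `|h|%:E * nu B)%E.
  move=> mB.
  rewrite -[LHS](measure_addE (p h) (m h)).
  have -> : (`|h|%:E * nu B = mscale (NngNum (normr_ge0 h)) nu B)%E by [].
  have E a b : a <= b -> measure_add (p h) (m h) `]a, b]%classic =
      (`|h| * (W b - W a))%:E.
    move=> ab; rewrite measure_addE/= pE// mE// -EFinD.
    by congr (_%:E); rewrite /upper_marginal /lower_marginal; lra.
  apply: eq_measure_ocitv mB => a b ab; first by rewrite [X in (X < _)%E]E// ltry.
  by rewrite [LHS]E//= /mscale/= nuE.
have repE B x : measurable B -> represents ip p m B x ->
    forall h, (ip x h)%:E = (p h B - m h B)%E.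
  by move=> mB hx h; rewrite hx EFinB !fineK ?fin_num_measure.
have [|mu [h1 h2 h3 h4]] := vector_measure_ex hip pm.
  move=> a b ab; exists (G b - G a) => h; rewrite pE// mE//=.
  by rewrite (ipBl hip) /upper_marginal /lower_marginal; lra.
exists mu, nu, p, m; split => //.
- by move=> h B mB; apply: repE => //; exact: h3.
- by move=> h a b ab; rewrite pE// mE.
Qed.

End vector_stieltjes.

Section right_continuous_version.
Context {R : realType} {H : completeNormedModType R}.
Variables (g : R -> H) (V : R -> R) (c M : R).
Hypothesis Vnd : {homo V : x y / x <= y}.
Hypothesis VM : forall x, 0 <= V x <= M.
Hypothesis gV : forall t s, c < t -> t < s -> `|g s - g t| <= V s - V t.

(** Take right limits of both [g] and [V]; they differ from the originals only at
    jumps of [V]. To the left of [c], where [g] is not controlled, the version is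
    extended by its right limit at [c], so that the extension adds no mass. *)
Lemma right_continuous_version_ex : exists (G : R -> H) (W : R -> R),
  [/\ forall t s, t <= s -> `|G s - G t| <= W s - W t,
      forall x, W @ at_right x --> W x,
      forall x, `|W x| <= M,
      forall x, x <= c -> W x = W c
    & countable [set t | c < t /\ g t <> G t]].
Proof.
pose e t := Num.max t c.
pose xs t (n : nat) := e t + n.+1%:R^-1.
have ce t : c <= e t by rewrite le_max lexx orbT.
have te t : t <= e t by rewrite le_max lexx.
have exs t n : e t < xs t n by rewrite ltrDl invr_gt0.
have xsc t n : c < xs t n by apply: le_lt_trans (exs t n).
have xs_dec t n m : (n <= m)%N -> xs t m <= xs t n.
  by move=> nm; rewrite lerD2l lef_pV2 ?posrE// ler_nat.
have gVle t s : c < t -> t <= s -> `|g s - g t| <= V s - V t.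
  move=> ct; rewrite le_eqVlt => /predU1P[->|]; first by rewrite !subrr normr0.
  exact: gV.
have near_lt t x : e t < x -> \forall n \near \oo, xs t n < x.
  move=> tx; near=> n; rewrite -ltrBrDl; near: n.
  have d0 : 0 < x - e t by rewrite subr_gt0.
  exact: (near_infty_natSinv_lt (PosNum d0)).
have /choice[W hW] t : exists l : R, V (xs t n) @[n --> \oo] --> l.
  exists (limn (V \o xs t)); apply: nonincreasing_is_cvgn.
    by move=> n m nm; apply: Vnd; exact: xs_dec.
  by exists 0 => _ [n _ <-] /=; case/andP: (VM (xs t n)).
have /choice[G hG] t : exists x : H, g (xs t n) @[n --> \oo] --> x.
  apply: (@dominated_cvg _ _ _ (fun n => - V (xs t n)) 0) => [n m nm|n].
    by rewrite distrC opprK [leRHS]addrC; apply: gVle => //; exact: xs_dec.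
  by rewrite oppr_le0; case/andP: (VM (xs t n)).
have We t s : e t = e s -> W t = W s.
  move=> ets; apply: (@cvg_unique _ _ ((fun n => V (xs t n)) @ \oo)).
  - exact: norm_hausdorff.
  - exact: hW.
  - by rewrite (_ : xs t = xs s); [exact: hW|rewrite /xs ets].
have Ge t s : e t = e s -> G t = G s.
  move=> ets; apply: (@cvg_unique _ _ ((fun n => g (xs t n)) @ \oo)).
  - exact: norm_hausdorff.
  - exact: hG.
  - by rewrite (_ : xs t = xs s); [exact: hG|rewrite /xs ets].
have WV t x : e t < x -> W t <= V x.
  move=> tx; apply: (cvgr_to_le (hW t)); apply: filterS (near_lt _ _ tx) => n.
  by move/ltW; exact: Vnd.
have VW t : V (e t) <= W t.
  apply: (cvgr_to_ge (hW t)); near=> n; apply: Vnd; exact: ltW.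
have gG t x : e t < x -> `|g x - G t| <= V x - W t.
  move=> tx; apply: (@ler_cvg_to _ \oo _ _ (fun n => `|g x - g (xs t n)|)
    (fun n => V x - V (xs t n))).
  - by apply: cvg_norm; apply: cvgB; [exact: cvg_cst|exact: hG].
  - by apply: cvgB; [exact: cvg_cst|exact: hW].
  - by apply: filterS (near_lt _ _ tx) => n /ltW; exact: gVle.
have GW t s : t <= s -> `|G s - G t| <= W s - W t.
  move=> ts; have [ets|ets] := eqVneq (e t) (e s).
    by rewrite (Ge _ _ ets) (We _ _ ets) !subrr normr0.
  have lets : e t < e s.
    by rewrite lt_neqAle ets /e ge_max !le_max ts lexx !orbT.
  apply: (@ler_cvg_to _ \oo _ _ (fun n => `|g (xs s n) - G t|)
    (fun n => V (xs s n) - W t)).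
  - by apply: cvg_norm; apply: cvgB; [exact: hG|exact: cvg_cst].
  - by apply: cvgB; [exact: hW|exact: cvg_cst].
  - by near=> n; apply: gG; exact: lt_trans (exs s n).
have Wnd : {homo W : x y / x <= y}.
  by move=> x y /GW/(le_trans (normr_ge0 _)); rewrite subr_ge0.
exists G, W; split=> //.
- move=> t; apply/cvgrPdist_lt => d d0.
  have /cvgrPdist_lt/(_ _ d0)/filter_ex[n hn] := hW t.
  near=> s.
  have ts : t < s by near: s; exact: nbhs_right_gt.
  have sx : s < xs t n.
    by near: s; apply: nbhs_right_lt; exact: le_lt_trans (exs t n).
  rewrite ler0_norm ?subr_le0 ?Wnd ?(ltW ts)//.
  have : W s <= V (xs t n) by apply: WV; rewrite gt_max sx xsc.
  move: hn; rewrite distrC; have := ler_norm (V (xs t n) - W t); lra.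
- move=> x; rewrite ger0_norm; last first.
    by apply: le_trans (VW x); case/andP: (VM (e x)).
  have := WV x _ (exs x 0%N); move/le_trans; apply.
  by case/andP: (VM (xs x 0%N)).
- by move=> x xc; apply: We; rewrite /e maxxx; apply/max_idPr.
- apply: sub_countable (countable_jumps c V); apply: subset_card_le.
  move=> t /= [ct gGt]; split => //; exists (V t), (W t).
  have et : e t = t by apply/max_idPl; exact: ltW.
  split.
  + rewrite lt_neqAle -{3}et VW andbT; apply/eqP => VWt; apply: gGt.
    apply/eqP; rewrite -subr_eq0 -normr_eq0 eq_le normr_ge0 andbT distrC.
    rewrite -(subrr (V t)) {1}VWt.
    apply: (@ler_cvg_to _ \oo _ _ (fun n => `|g (xs t n) - g t|)
      (fun n => V (xs t n) - V t)).
    * by apply: cvg_norm; apply: cvgB; [exact: hG|exact: cvg_cst].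
    * by apply: cvgB; [exact: hW|exact: cvg_cst].
    * by near=> n; apply: gV => //; rewrite -{1}et.
  + by move=> s _ /ltW; exact: Vnd.
  + by move=> s ts; apply: WV; rewrite et.
Unshelve. all: by end_near. Qed.

End right_continuous_version.

Section test_functions.
Context {R : realType}.

Lemma test_function_derivable (I : set R) (phi : R -> R) : test_function I phi ->
  (forall x, derivable phi x 1) /\ continuous (derive1 phi).
Proof.
move=> [sm _ _]; split=> [x|x]; first exact: (sm 0%N).
by apply: differentiable_continuous; apply/derivable1_diffP; exact: (sm 1%N).
Qed.

Lemma test_function_out (I : set R) (phi : R -> R) x : test_function I phi ->
  ~ I x -> derive1 phi x = 0.
Proof.
move=> [_ _ sI] nIx; rewrite derive1E.
have : \forall y \near x, phi y = cst 0 y.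
  have nK : (~` closure [set y | phi y != 0]) x by move/sI.
  have oK : open (~` closure [set y | phi y != 0]).
    by apply: closed_openC; exact: closed_closure.
  have := open_nbhs_nbhs (conj oK nK); apply: filterS => y /= ny.
  apply/eqP; apply: contra_notT ny => y0; exact: subset_closure.
by move/(near_eq_derive (f := phi)) => ->; rewrite derive_cst.
Qed.

Lemma test_function_itv (I : set R) (phi : R -> R) : test_function I phi ->
  exists a b, [/\ a < b, forall x, ~ (a < x < b) -> phi x = 0
    & forall x, ~ (a < x < b) -> derive1 phi x = 0].
Proof.
move=> tphi; have [sm cK sI] := tphi.
have [M [_ /(_ (M + 1))]] := compact_bounded cK.
rewrite ltrDl ltr01 => /(_ isT) hM.
have K x : ~ (- (`|M| + 2) < x < `|M| + 2) -> ~ closure [set x | phi x != 0] x.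
  move=> nx /hM /= xM; apply: nx; rewrite -ltr_norml.
  by rewrite (le_lt_trans xM)//; have := ler_norm M; lra.
exists (- (`|M| + 2)), (`|M| + 2); split => [|x /K nx|x /K nx].
- by have := normr_ge0 M; lra.
- by apply/eqP; apply: contra_notT nx => x0; exact: subset_closure.
- by apply: (@test_function_out (closure [set x | phi x != 0])) => //; split.
Qed.

End test_functions.

(** Countable sets and all their subsets are Borel. *)
Lemma measurable_fun_countable_modif (R : realType) (D N : set R) (f g : R -> R) :
  measurable D -> countable N -> measurable_fun setT f ->
  (forall x, D x -> ~ N x -> g x = f x) -> measurable_fun D g.
Proof.
move=> mD cN mf fg _ Y mY.
have -> : D `&` g @^-1` Y = ((D `&` f @^-1` Y) `\` N) `|` (N `&` (D `&` g @^-1` Y)).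
  apply/seteqP; split=> [x [Dx gx]|x [[[Dx fx] nN]|[_ //]]].
    by have [Nx|nN] := pselect (N x); [right|left; split=> //; split=> //; rewrite /= -fg].
  by split=> //; rewrite /= fg.
apply: measurableU; last first.
  apply: countable_measurable => //; apply: sub_countable cN.
  by apply: subset_card_le => x [].
apply: measurableD; last exact: countable_measurable.
by apply: measurableI => //; rewrite -[X in measurable X]setTI; exact: mf.
Qed.

Section dominated_paths.
Context {R : realType} {H : completeNormedModType R}.
Variable ip : H -> H -> R.
Hypothesis hip : is_inner_product ip.
Variables (g : R -> H) (V : R -> R) (c M : R).
Hypothesis Vnd : {homo V : x y / x <= y}.
Hypothesis VM : forall x, 0 <= V x <= M.
Hypothesis gV : forall t s, c < t -> t < s -> `|g s - g t| <= V s - V t.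
Variable I : set R.
Hypothesis mI : measurable I.
Hypothesis I_interior : I° = `]c, +oo[%classic.
Hypothesis I_sub : I `<=` `[c, +oo[%classic.

Let Ic x : I x -> x <> c -> c < x.
Proof.
move=> /I_sub; rewrite /= in_itv/= andbT lt_neqAle => -> /eqP.
by rewrite eq_sym => ->.
Qed.

(** The derivative is the vector measure of the right-continuous version [G] of
    [g]. It does not charge the left of [c], where [G] is constant, and the
    distributional identity for [G] is the one for [g] because the two differ only
    at countably many points. *)
Lemma bv_path_dominated : bv_path ip I g.
Proof.
have [G [W [GW Wrc WM Wc cN]]] := right_continuous_version_ex Vnd VM gV.
set N := [set t | c < t /\ g t <> G t] in cN.
have [mu [nu [p [m [[h1 h2] h3 h4 h5 h6]]]]] := vector_stieltjes_ex hip GW Wrc WM.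
have Wnd : {homo W : x y / x <= y}.
  by move=> x y /GW/(le_trans (normr_ge0 _)); rewrite subr_ge0.
have mip h : measurable_fun setT (fun t => ip (G t) h).
  have -> : (fun t => ip (G t) h) = upper_marginal ip G W h \- lower_marginal ip G W h.
    by apply/funext => t; rewrite /upper_marginal /lower_marginal /=; lra.
  apply: measurable_funB; apply: nondecreasing_measurable => //.
    exact: upper_marginal_nd.
  exact: lower_marginal_nd.
have mnorm : measurable_fun setT (fun t => `|G t|).
  have -> : (fun t => `|G t|) = (fun t => `|G t| + W t) \- W.
    by apply/funext => t /=; rewrite addrK.
  apply: measurable_funB; apply: nondecreasing_measurable => // x y xy.
  have := GW _ _ xy; have := ler_distD 0 (G x) (G y).
  by rewrite subr0 sub0r normrN distrC; have := lerB_dist (G x) (G y); rewrite distrC; lra.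
have cNc : countable (N `|` [set c]).
  rewrite -bigcup2E; apply: bigcup_countable => // -[|[|i]] _ //=.
have gG x : I x -> ~ (N `|` [set c]) x -> g x = G x.
  move=> Ix /not_orP[nN nc]; apply: contrapT => gGx; apply: nN; split => //.
  exact: Ic.
have gb : exists B, forall x, I x -> `|g x| <= B.
  exists (Num.max (`|g c|) (`|g (c + 1)| + M)) => x Ix; rewrite le_max.
  have [->|xc] := eqVneq x c; first by rewrite lexx.
  apply/orP; right; rewrite -[g x](subrK (g (c + 1))) addrC.
  rewrite (le_trans (ler_normD _ _))// lerD2l.
  have cx := Ic Ix (elimN eqP xc).
  have /andP[a1 a2] := VM x; have /andP[a3 a4] := VM (c + 1).
  have cc : c < c + 1 by rewrite ltrDl.
  have [xl|xl|->] := ltgtP x (c + 1); last by rewrite subrr normr0; lra.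
    by rewrite distrC (le_trans (gV cx xl))//; lra.
  by rewrite (le_trans (gV cc xl))//; lra.
exists mu; split => //.
- split=> [h|K cK KI].
    by apply: (measurable_fun_countable_modif mI cNc (mip h)) => x Ix nN; rewrite gG.
  have mK : measurable K by apply: closed_measurable; exact: compact_closed.
  apply: (@measurable_bounded_integrable _ (measurableTypeR R) R lebesgue_measure
    (fun t : R => `|g t|) K) => //.
  + have [B [_ /(_ (B + 1))]] := compact_bounded cK.
    rewrite ltrDl ltr01 => /(_ isT); set L := `[- (B + 1), B + 1]%classic => hB.
    have hl : (lebesgue_measure L < +oo)%E.
      by rewrite lebesgue_measure_itv /=; case: ifP; rewrite ?ltry// -EFinB ltry.
    have : (lebesgue_measure K <= lebesgue_measure L)%E.
      apply: le_measure; rewrite ?inE//; first exact: measurable_itv.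
      by move=> x Kx; rewrite /L /= in_itv/= -ler_norml; exact: hB.
    by move=> hle; exact: le_lt_trans hle hl.
  + apply: (measurable_fun_countable_modif mK cNc mnorm) => x Kx nN.
    by rewrite gG//; exact: KI.
  + have [B hB] := gb; exists B; split; first exact: num_real.
    move=> y By x Kx /=; rewrite normr_id (le_trans _ (ltW By))//.
    by apply: hB; exact: KI.
have nu0 : nu `]-oo, c]%classic = 0%E.
  have cm : (nu \o (fun n : nat => `]c - n%:R, c]%classic)) @ \oo -->
      nu (\bigcup_n `]c - n%:R, c]%classic).
    apply: nondecreasing_cvg_mu => //; first exact: bigcup_measurable.
    move=> n k nk; apply/subsetPset/subset_itv => //.
    by rewrite leBSide/= lerD2l lerN2 ler_nat.
  have e0 : nu \o (fun n : nat => `]c - n%:R, c]%classic) = cst 0%E.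
    apply/funext => n /=; rewrite h5 ?gerBl// Wc ?subrr//.
    by rewrite gerBl.
  have -> : `]-oo, c]%classic = \bigcup_n `]c - n%:R, c]%classic.
    apply/seteqP; split=> x /=; rewrite ?in_itv/=; last first.
      by move=> [n _]; rewrite /= in_itv/= => /andP[].
    move=> xc; exists (Num.bound `|c - x|) => //=; rewrite in_itv/= xc andbT.
    by rewrite ltrBlDr -ltrBlDl (le_lt_trans (ler_norm _))// archi_boundP.
  rewrite e0 in cm; apply: (@cvg_unique _ _ (cst 0%E @ \oo) _ _ _ cm) => //.
  exact: cvg_cst.
have mu_out B : measurable B -> B `<=` `]-oo, c]%classic -> mu B = 0.
  move=> mB Bc; have := h3 _ mB.
  have : (nu B <= nu `]-oo, c]%classic)%E by rewrite le_measure ?inE.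
  rewrite nu0 => nuB /le_trans/(_ nuB).
  by rewrite lee_fin normr_le0 => /eqP.
rewrite I_interior; split=> [B mB|h].
  have mBI : measurable (B `&` `]c, +oo[%classic) by exact: measurableI.
  have mBO : measurable (B `\` `]c, +oo[%classic) by exact: measurableD.
  apply: (ip_inj hip) => h.
  apply: EFin_inj; rewrite !h4//.
  have pf (q : {finite_measure set R -> \bar R}) X : measurable X ->
      q X = (fine (q X))%:E by move=> mX; rewrite fineK// fin_num_measure.
  have out : fine (p h (B `\` `]c, +oo[%classic)) =
      fine (m h (B `\` `]c, +oo[%classic)).
    have := h4 h _ mBO; rewrite mu_out//; last first.
      by move=> x [_ /negP]; rewrite /= !in_itv/= andbT -leNgt.
    by rewrite (ip0l hip) (pf (p h))// (pf (m h))// -EFinB => -[]; lra.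
  have dec (q : {finite_measure set R -> \bar R}) : fine (q B) =
      fine (q (B `&` `]c, +oo[%classic)) + fine (q (B `\` `]c, +oo[%classic)).
    rewrite -fineD ?fin_num_measure// -measureU//; first by rewrite setUIDK.
    by rewrite setDE setIACA setICr setI0.
  rewrite (pf (p h) _ mB) (pf (m h) _ mB) (pf (p h) _ mBI) (pf (m h) _ mBI).
  rewrite -!EFinB (dec (p h)) (dec (m h)) out.
  by congr (_%:E); lra.
exists (p h), (m h); split=> [B mB|phi tphi]; first exact: h4.
have [a [b [ab phi0 dphi0]]] := test_function_itv tphi.
have [dphi cphi] := test_function_derivable tphi.
have [K hK] := marginal_bound hip GW WM h.
have und := @upper_marginal_nd _ _ _ hip _ _ GW h.
have lnd := @lower_marginal_nd _ _ _ hip _ _ GW h.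
have ub x := (hK x).1; have lb x := (hK x).2.
rewrite (stieltjes_by_parts und ub (fun a b ab => (h6 h a b ab).1) ab dphi cphi phi0 dphi0).
rewrite (stieltjes_by_parts lnd lb (fun a b ab => (h6 h a b ab).2) ab dphi cphi phi0 dphi0).
have iu := integrable_derive_mul ab cphi dphi0
  (nondecreasing_measurable (@measurableT _ R) und) ub.
have il := integrable_derive_mul ab cphi dphi0
  (nondecreasing_measurable (@measurableT _ R) lnd) lb.
rewrite opprK opprD opprK -[RHS]RintegralB//.
rewrite Rintegral_mkcond /Rintegral; congr fine.
have cae : lebesgue_measure.-negligible (N : set R).
  exists N; split => //.
  - exact: countable_measurable.
  - exact: countable_lebesgue_measure0.
have eqN x : setT x -> ~ N x ->
    ((fun t => ip (g t) h * derive1 phi t) \_ `]c, +oo[) x =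
    derive1 phi x * upper_marginal ip G W h x
    - derive1 phi x * lower_marginal ip G W h x.
  move=> _ nN; rewrite patchE -mulrBr; case: ifPn.
    rewrite inE /= in_itv/= andbT => cx.
    have -> : g x = G x by apply: contrapT => gx; apply: nN.
    by rewrite mulrC /upper_marginal /lower_marginal; congr (_ * _); lra.
  by rewrite notin_setE => nx; rewrite (test_function_out tphi) ?mul0r ?subrr.
have mr : measurable_fun setT (fun x => derive1 phi x * upper_marginal ip G W h x
    - derive1 phi x * lower_marginal ip G W h x).
  have mphi : measurable_fun setT (derive1 phi) by exact: continuous_measurable_fun.
  apply: measurable_funB; apply: measurable_funM => //;
    exact: nondecreasing_measurable.
apply: ae_eq_integral => //.
- apply/measurable_EFinP.
  exact: (measurable_fun_countable_modif (@measurableT _ R) cN mr).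
- exact/measurable_EFinP.
- apply: negligibleS cae => x /= nx; apply: contrapT => nN; apply: nx => _.
  by rewrite eqN.
Qed.

End dominated_paths.

(** * Smooth bumps and atoms of the derivative *)

Section iterated_derivatives.
Context {R : realType}.
Implicit Types (f g : R -> R) (k n : nat).

(** Differentiating inside the recursion, rather than taking [derive1n], lets the
    closure properties below be proved by induction on [k] alone. *)
Fixpoint times_derivable k f : Prop :=
  if k is k'.+1 then (forall x : R, derivable f x 1) /\ times_derivable k' (derive1 f)
  else True.

Lemma is_derive_times k f (x : R) : times_derivable k.+1 f ->
  is_derive x 1 f (derive1 f x).
Proof. by move=> [df _]; rewrite derive1E; apply: derivableP. Qed.

Lemma times_derivableS k f f' : (forall x : R, is_derive x 1 f (f' x)) ->
  times_derivable k f' -> times_derivable k.+1 f.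
Proof.
move=> df; have -> : f' = derive1 f.
  by apply/funext => x; rewrite derive1E derive_val.
by move=> Cf'; split=> // x; have [] := df x.
Qed.

Lemma times_derivableW k f : times_derivable k.+1 f -> times_derivable k f.
Proof. by elim: k f => // k IH f [df /IH]. Qed.

Lemma times_derivableD k f g : times_derivable k f -> times_derivable k g ->
  times_derivable k (f \+ g).
Proof.
elim: k f g => // k IH f g Cf Cg.
apply: (@times_derivableS _ _ (derive1 f \+ derive1 g)) => [x|].
  by apply: is_deriveD; [exact: is_derive_times Cf|exact: is_derive_times Cg].
by apply: IH; [exact: Cf.2|exact: Cg.2].
Qed.

Lemma times_derivableM k f g : times_derivable k f -> times_derivable k g ->
  times_derivable k (f \* g).
Proof.
elim: k f g => // k IH f g Cf Cg.
apply: (@times_derivableS _ _ ((f \* derive1 g) \+ (g \* derive1 f))) => [x|].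
  by apply: is_deriveM; [exact: is_derive_times Cf|exact: is_derive_times Cg].
apply: times_derivableD; apply: IH.
- exact: times_derivableW.
- exact: Cg.2.
- exact: times_derivableW.
- exact: Cf.2.
Qed.

Lemma times_derivable_cst k (c : R) : times_derivable k (cst c).
Proof.
by elim: k c => // k IH c; apply: (@times_derivableS _ _ (cst 0)); exact: IH.
Qed.

Lemma times_derivable_affine k f (a b : R) : times_derivable k f ->
  times_derivable k (fun x => f (a * x + b)).
Proof.
elim: k f => // k IH f Cf.
apply: (@times_derivableS _ _ ((fun x => derive1 f (a * x + b)) \* cst a)) => [x|].
  apply: (@is_derive1_comp _ f (fun x => a * x + b)).
    exact: is_derive_times Cf.
  have -> : (fun x => a * x + b) = (a *: id) \+ cst b by apply/funext.
  apply: is_derive_eq; rewrite addr0 /GRing.scale/=; exact: mulr1.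
apply: times_derivableM; first by apply: IH; exact: Cf.2.
exact: times_derivable_cst.
Qed.

Lemma times_derivable_derive1n f n (x : R) : times_derivable n.+1 f ->
  derivable (derive1n n f) x 1.
Proof.
elim: n f => [|n IH] f Cf; first exact: Cf.1.
by rewrite derive1Sn; apply: IH; exact: Cf.2.
Qed.

End iterated_derivatives.

Section bump.
Context {R : realType}.

(** The powers [n] make the family stable under differentiation, up to linear
    combinations, so that smoothness follows by induction. *)
Definition flat n (x : R) : R :=
  if 0 < x then x^-1 ^+ n * expR (- x^-1) else 0.

Lemma flat_le0 n x : x <= 0 -> flat n x = 0.
Proof. by rewrite /flat leNgt => /negbTE ->. Qed.

Lemma flat_ge0 n x : 0 <= flat n x.
Proof.
rewrite /flat; case: ifP => // x0.
by rewrite mulr_ge0 ?expR_ge0// exprn_ge0// invr_ge0 ltW.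
Qed.

Lemma flat0_le1 x : flat 0 x <= 1.
Proof.
rewrite /flat; case: ifP => // x0.
by rewrite expr0 mul1r -expR0 ler_expR oppr_le0 invr_ge0 ltW.
Qed.

(** Raise [y / n <= exp (y / n)] to the power [n]. *)
Lemma exp_dominates n (y : R) : 0 <= y -> y ^+ n.+1 <= n.+1%:R ^+ n.+1 * expR y.
Proof.
move=> y0; have n0 : 0 < n.+1%:R :> R by rewrite ltr0n.
have -> : expR y = expR (y / n.+1%:R) ^+ n.+1.
  by rewrite -expRM_natl mulrC divfK// gt_eqF.
have h : y <= n.+1%:R * expR (y / n.+1%:R).
  by rewrite mulrC -ler_pdivrMr// (le_trans _ (expR_ge1Dx _))// lerDr.
by rewrite -exprMn lerXn2r// nnegrE (le_trans y0).
Qed.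

(** A quadratic bound is what the derivative at [0] needs. *)
Lemma flat_quadratic n x : flat n x <= n.+2%:R ^+ n.+2 * x ^+ 2.
Proof.
rewrite /flat; case: ifP => [x0|_]; last by rewrite mulr_ge0// ?sqr_ge0 ?exprn_ge0.
have y0 : 0 < x^-1 by rewrite invr_gt0.
have -> : x ^+ 2 = (x^-1 ^+ 2)^-1 by rewrite exprVn invrK.
rewrite expRN ler_pdivrMr ?expR_gt0// mulrAC ler_pdivlMr ?exprn_gt0//.
by rewrite -exprD addn2; exact: exp_dominates (ltW y0).
Qed.

Lemma is_derive_flat n (x : R) : is_derive x 1 (flat n) (flat n.+2 x - n%:R * flat n.+1 x).
Proof.
have [x0|x0|->] := ltgtP x 0.
- rewrite !flat_le0 ?ltW// mulr0 subr0.
  apply: (near_eq_is_derive (f := cst 0)).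
  by near=> y; rewrite flat_le0// ltW//; near: y; exact: lt_nbhsl.
- have xn0 : x != 0 by rewrite gt_eqF.
  have EX k (y : R) : ((fun y : R => y^-1) ^+ k) y = y^-1 ^+ k.
    by elim: k => // k IH; rewrite !exprS -IH.
  have dV : is_derive x 1 (fun y : R => y^-1) (- x ^- 2).
    apply: is_derive_eq (is_deriveV (f := id) (t := 1) _ _) _ => //.
    by rewrite /GRing.scale/= mulr1.
  have dX := is_deriveX n dV.
  have dE : is_derive x 1 (expR \o (fun y : R => - y^-1))
      (expR (- x^-1) * (- - x ^- 2)).
    by apply: is_derive1_comp.
  have dM := is_deriveM dX dE.
  apply: (near_eq_is_derive _ (is_derive_eq dM _)).
    near=> y; rewrite /flat; have -> : 0 < y by near: y; exact: lt_nbhsr.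
    by rewrite -(EX n y).
  rewrite EX /flat x0 /GRing.scale/= -exprVn.
  case: n {dX dM EX} => [|n]; first by rewrite !mul0r mulr0 subr0 expr0; ring.
  by rewrite !exprS; ring.
rewrite !flat_le0// mulr0 subr0.
have quad h : `|flat n h| <= n.+2%:R ^+ n.+2 * h ^+ 2.
  by rewrite ger0_norm ?flat_ge0//; exact: flat_quadratic.
have K0 : 0 < n.+2%:R ^+ n.+2 :> R by rewrite exprn_gt0.
have lim0 : h^-1 *: (flat n (h *: 1 + 0) - flat n 0) @[h --> (0 : R)^'] --> (0 : R).
  apply/cvgrPdist_le => e e0; near=> h.
  have h0 : 0 < `|h| by rewrite normr_gt0; near: h; exact: nbhs_dnbhs_neq.
  rewrite sub0r normrN addr0 (flat_le0 n (lexx 0)) subr0 /GRing.scale/= mulr1.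
  rewrite normrM normfV ler_pdivrMl// (le_trans (quad h))//.
  rewrite -real_normK ?num_real// expr2 mulrCA ler_wpM2l//.
  rewrite mulrC -ler_pdivlMr//; near: h; apply: dnbhs0_le.
  by rewrite divr_gt0.
apply: DeriveDef; first by apply/cvg_ex; exists 0.
exact: cvg_lim lim0.
Unshelve. all: by end_near. Qed.

Lemma times_derivable_flat k n : times_derivable k (flat n).
Proof.
elim: k n => // k IH n.
apply: (@times_derivableS _ _ _ (flat n.+2 \+ cst (- n%:R) \* flat n.+1)) => [x|].
  by rewrite /= mulNr; exact: is_derive_flat.
apply: times_derivableD; first exact: IH.
by apply: times_derivableM; [exact: times_derivable_cst|exact: IH].
Qed.

(** The two factors vanish on the left of [t - r^-1] and on the right of
    [t + r^-1] respectively. *)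
Definition bump (t r x : R) : R :=
  flat 0 (r * x + (1 - r * t)) * flat 0 (- r * x + (1 + r * t)).

Lemma bump_ge0 t r x : 0 <= bump t r x.
Proof. by rewrite mulr_ge0 ?flat_ge0. Qed.

Lemma bump_le1 t r x : bump t r x <= 1.
Proof. by rewrite mulr_ile1 ?flat_ge0 ?flat0_le1. Qed.

Lemma bump_center t r : bump t r t = flat 0 1 ^+ 2.
Proof. by rewrite /bump expr2; congr (flat 0 _ * flat 0 _); ring. Qed.

Lemma bump_out t r x : 1 <= r * `|x - t| -> bump t r x = 0.
Proof.
move=> h; rewrite /bump; have [xt|xt] := leP t x.
  rewrite [X in _ * X]flat_le0 ?mulr0//.
  by move: h; rewrite ger0_norm ?subr_ge0//; lra.
rewrite flat_le0 ?mul0r//.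
by move: h; rewrite ltr0_norm ?subr_lt0//; lra.
Qed.

Lemma bump_test_function (t r : R) (I : set R) : 0 < r ->
  (forall x, `|x - t| <= r^-1 -> I x) -> test_function I (bump t r).
Proof.
move=> r0 hI.
have sub : closure [set x | bump t r x != 0] `<=` `[t - r^-1, t + r^-1].
  have /closure_id -> : closed `[t - r^-1, t + r^-1]%classic.
    exact: itv_closed.
  apply: closure_subset => x /= bx; rewrite in_itv/= -ler_distl.
  rewrite leNgt; apply: contra bx => xt.
  by rewrite bump_out// -ler_pdivrMl// mulr1 ltW.
split.
- move=> n x; apply: times_derivable_derive1n; apply: times_derivableM;
    apply: times_derivable_affine; exact: times_derivable_flat.
- apply: subclosed_compact sub; first exact: closed_closure.
  exact: segment_compact.
- by move=> x /sub /=; rewrite in_itv/= -ler_distl; exact: hI.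
Qed.

End bump.

Section atoms.
Context {R : realType}.

(** The bumps decrease in width to the indicator of [t], up to their common value
    at [t]; conclude by dominated convergence. *)
Lemma bump_integral_cvg (q : {finite_measure set R -> \bar R}) (t : R) (r : nat -> R) :
  (forall n, 0 < r n) -> r @ \oo --> +oo ->
  (\int[q]_x bump t (r n) x) @[n --> \oo] --> flat 0 1 ^+ 2 * fine (q [set t]).
Proof.
move=> r0 roo; set k := (flat 0 (1 : R) ^+ 2 : R).
have mb n : measurable_fun setT (bump t (r n)).
  have [|db _] := @test_function_derivable _ setT (bump t (r n)).
    exact: bump_test_function.
  apply: continuous_measurable_fun => x; apply: differentiable_continuous.
  exact/derivable1_diffP.
have mt : measurable_fun setT (fun x : R => k * \1_[set t] x).
  by apply: measurable_funM => //; exact: measurable_indic.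
have cv : {ae q, forall x, setT x ->
    (bump t (r n) x)%:E @[n --> \oo] --> (k * \1_[set t] x)%:E}.
  apply: aeW => x _; apply/cvg_EFin; first by near=> n.
  have [->|xt] := eqVneq x t.
    rewrite indicE mem_set// mulr1.
    have -> : fine \o (fun n => (bump t (r n) t)%:E) = cst k.
      by apply/funext => n /=; rewrite bump_center.
    exact: cvg_cst.
  rewrite indicE memNset; last by apply/eqP.
  rewrite mulr0; apply: cvg_near_cst.
  have d0 : 0 < `|x - t| by rewrite normr_gt0 subr_eq0.
  near=> n => /=; rewrite bump_out// -ler_pdivrMr// ltW//.
  by near: n; exact: (cvgryPgt _).1.
have dom : {ae q, forall x n, setT x -> (`|(bump t (r n) x)%:E| <= cst 1 x)%E}.
  by apply: aeW => x n _ /=; rewrite lee_fin ger0_norm ?bump_ge0// bump_le1.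
have [_ _ dc] := @dominated_convergence _ R R q setT measurableT
  (fun n x => (bump t (r n) x)%:E) (fun x => (k * \1_[set t] x)%:E) (cst 1%E)
  (fun n => (measurable_EFinP _ _).2 (mb n)) ((measurable_EFinP _ _).2 mt)
  cv (finite_measure_integrable_cst q 1 measurableT) dom.
have ii : q.-integrable setT (EFin \o (\1_[set t] : R -> R)).
  exact: integrable_indic.
have e : (\int[q]_x (k * \1_[set t] x)%:E = (k * fine (q [set t]))%:E)%E.
  rewrite [RHS]EFinM fineK ?fin_num_measure//.
  transitivity (\int[q]_x (k%:E * (\1_[set t] x)%:E))%E.
    by apply: eq_integral => x _; rewrite EFinM.
  by rewrite integralZl// integral_indic// setIT.
by rewrite e in dc; exact: fine_cvg dc.
Unshelve. all: by end_near. Qed.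

(** Where the path is constant, its pairing with the derivative of a bump
    vanishes, and bumps shrinking to a point see the mass of that point. *)
Lemma bv_derivative_no_atom (H : normedModType R) (ip : H -> H -> R)
    (I : set R) (g : R -> H) (mu : set R -> H) (a b t : R) (y : H) :
  is_inner_product ip -> is_bv_derivative ip I g mu ->
  `]a, b[%classic `<=` I° -> (forall s, a < s < b -> g s = y) ->
  a < t < b -> mu [set t] = 0.
Proof.
move=> hip [_ _ _ [_ hmu]] abI gy /andP[at_ tb].
have ab : a < b by exact: lt_trans tb.
apply: (ip_inj hip) => h; rewrite (ip0l hip).
have [p [m [pm tst]]] := hmu h.
pose d := Num.min (t - a) (b - t) / 2.
have d0 : 0 < d by rewrite divr_gt0// lt_min !subr_gt0 at_.
have dta : d < t - a.
  have : Num.min (t - a) (b - t) <= t - a by rewrite ge_min lexx.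
  by rewrite /d; move: (d0); rewrite /d; lra.
have dbt : d < b - t.
  have : Num.min (t - a) (b - t) <= b - t by rewrite ge_min lexx orbT.
  by rewrite /d; move: (d0); rewrite /d; lra.
pose r (n : nat) := n.+1%:R / d.
have r0 n : 0 < r n by rewrite divr_gt0.
have roo : r @ \oo --> +oo.
  apply/cvgryPgt => K; near=> n; rewrite /r ltr_pdivlMr//.
  rewrite (@lt_trans _ _ n%:R) ?ltr_nat//.
  by near: n; exact: nbhs_infty_gtr.
have rd n : (r n)^-1 <= d.
  by rewrite /r invf_div ler_pdivrMr// ler_peMr ?ler1n// ltW.
have tf n : test_function `]a, b[%classic (bump t (r n)).
  apply: bump_test_function => // x /le_trans/(_ (rd n)).
  rewrite ler_distl /= in_itv/= => /andP[h1 h2]; apply/andP; lra.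
have eqpm n : \int[p]_x bump t (r n) x = \int[m]_x bump t (r n) x.
  have tfI : test_function I° (bump t (r n)).
    by have [h1 h2 h3] := tf n; split => //; exact: subset_trans abI.
  have [a' [b' [ab' phi0 dphi0]]] := test_function_itv (tf n).
  have [dphi cphi] := test_function_derivable (tf n).
  have i0 := integral_derive0 dphi cphi phi0 dphi0.
  have i1 : lebesgue_measure.-integrable setT
      (EFin \o derive1 (bump t (r n))).
    have := integrable_derive_mul ab' cphi dphi0
      (measurable_cst (1 : R)) (fun=> lexx `|1|).
    by under eq_fun do rewrite mulr1.
  have := tst _ tfI.
  have -> : \int[lebesgue_measure]_(t0 in I°)
      (ip (g t0) h * derive1 (bump t (r n)) t0) = 0.
    rewrite -[RHS](mulr0 (ip y h)) -i0 -RintegralZl//.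
    rewrite Rintegral_mkcond; apply: eq_Rintegral => x _; rewrite patchE.
    have [xab|xab] := pselect (`]a, b[%classic x).
      by rewrite mem_set ?gy//; exact: abI.
    by rewrite (test_function_out (tf n) xab) !mulr0; case: ifP.
  by move/esym/eqP; rewrite oppr_eq0 subr_eq0 => /eqP.
have pmt : fine (p [set t]) = fine (m [set t]).
  have k0 : flat 0 (1 : R) ^+ 2 != 0.
    by rewrite gt_eqF// exprn_gt0// /flat ltr01 expr0 mul1r expR_gt0.
  apply: (mulfI k0).
  apply: (@cvg_unique _ _ ((fun n => \int[p]_x bump t (r n) x) @ \oo)).
  - exact: norm_hausdorff.
  - exact: bump_integral_cvg.
  - by rewrite (funext eqpm); exact: bump_integral_cvg.
have := pm [set t] (measurable_set1 t).
have pf (q : {finite_measure set R -> \bar R}) :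
  q [set t] = (fine (q [set t]))%:E by rewrite fineK// fin_num_measure.
by rewrite (pf p) (pf m) pmt -EFinB subrr => -[].
Unshelve. all: by end_near. Qed.

End atoms.

(** * The regularization path *)

Unset Implicit Arguments.

Theorem proposition3p9 (R : realType)
  (Y X H : completeNormedModType R)
  (ip : H -> H -> R) (pair : X -> Y -> R)
  (A : {linear X -> H}) (J : X -> \bar R) (f : H)
  (hip : is_inner_product ip)
  (hY : separable Y)
  (hX : is_dual_pairing pair)
  (hA : continuous A)
  (J_ge0 : forall u, (0 <= J u)%E)
  (J_convex : convex_functional J)
  (J_proper : proper_functional J)
  (J_lsc : weak_star_lsc pair J)
  (J_homog : abs_one_homogeneous J)
  (hf : forall u, A u = f -> J u <> 0%E)
  (norm_equiv : exists c C : R, [/\ 0 < c, 0 < C &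
     forall u, nullset J u -> c * `|u| <= `|A u| /\ `|A u| <= C * `|u|])
  (poincare : exists C : R, 0 < C /\
     forall u, (`|u - null_proj A J (A u)|%:E <= C%:E * J u)%E)
  (A_weak : forall (u_ : nat -> X) (u : X),
     weak_star_cvg pair u_ u -> weak_cvg ip (fun k => A (u_ k)) (A u)) :
  {ae lebesgue_measure, forall t : R, 0 < t ->
     exists! g : H, exists u, is_minimizer A J f t u /\ A u = g} /\
  forall u : R -> X, (forall t, 0 < t -> is_minimizer A J f t (u t)) ->
    [/\ forall delta, 0 < delta -> bv_path ip `]delta, +oo[ (fun t => A (u t)),
        0 < t_star ip A J f -> bv_path ip `[0, +oo[ (fun t => A (u t))
      & forall delta mu, 0 <= delta ->
          is_bv_derivative ip `]delta, +oo[ (fun t => A (u t)) mu ->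
          vector_support (jump_part mu) `<=`
            [set t | t_star ip A J f <= t /\ (t%:E <= t_star_star ip A J f)%E]].
Proof.
have int_oy (d : R) : `]d, +oo[%classic° = `]d, +oo[%classic.
  exact: interior_itv_bndy.
split.
  exact: (ae_unique_image f hip hY hX hA J_ge0 J_convex J_lsc J_homog norm_equiv
            poincare A_weak).
move=> u hu; split.
- move=> delta d0.
  have [V [Vnd [M VM] gV]] := dominated_path_gt hip hY hX hA J_ge0 J_convex J_lsc
    J_homog norm_equiv poincare A_weak hu d0.
  apply: (bv_path_dominated hip Vnd VM gV) => // x /=.
  by rewrite !in_itv/= !andbT => /ltW.
- move=> ts0.
  have [V [Vnd [M VM] gV]] := dominated_path_gt0 hip hY hX hA J_ge0 J_convex J_lsc
    J_homog norm_equiv poincare A_weak hu ts0.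
  apply: (bv_path_dominated hip Vnd VM gV) => //.
  exact: interior_itv_bndy.
move=> delta mu d0 bmu t tsupp.
have [_ [mu0 _] _ [muI _]] := bmu.
have out s : s <= delta -> mu [set s] = 0.
  move=> sd; rewrite muI// int_oy -[RHS]mu0; congr mu.
  apply/seteqP; split=> x //= -[->]; rewrite in_itv/= andbT.
  by rewrite ltNge sd.
(* The jump part vanishes near [t] as soon as no point near [t] is an atom. *)
have no_supp (U : set R) : nbhs t U -> (forall s, U s -> mu [set s] = 0) -> False.
  move=> /tsupp[B [mB BU]] + hU; apply; rewrite /jump_part -[RHS]mu0; congr mu.
  by apply/seteqP; split=> x //= [/BU/hU].
split.
- rewrite leNgt; apply/negP => tts.
  apply: (no_supp `]-oo, (t_star ip A J f)[%classic).
    by apply: open_nbhs_nbhs; split => //; exact: interval_open.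
  move=> s; rewrite /= in_itv/= => sts; have [/out//|ds] := leP s delta.
  apply: (bv_derivative_no_atom (a := delta) (b := t_star ip A J f) (y := f)
    hip bmu).
  + by rewrite int_oy => x /=; rewrite !in_itv/= andbT => /andP[].
  + move=> x /andP[dx xt]; have x0 := le_lt_trans d0 dx.
    exact: (minimizer_lt_t_star hip J_ge0 J_homog x0 xt (hu x x0)).
  + by rewrite ds.
- rewrite leNgt; apply/negP => tts.
  have [a0 ha0 a0t] : exists2 a0 : R, (t_star_star ip A J f <= a0%:E)%E & a0 < t.
    move: tts; case: (t_star_star ip A J f) => [r| |]//.
      by rewrite lte_fin => rt; exists r.
    by exists (t - 1); rewrite ?leNye// ltrBlDr ltrDl.
  apply: (no_supp `]a0, +oo[%classic).
    apply: open_nbhs_nbhs; split; first exact: interval_open.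
    by rewrite /= in_itv/= andbT.
  move=> s; rewrite /= in_itv/= andbT => a0s; have [/out//|ds] := leP s delta.
  have am : Num.max delta a0 < s by rewrite gt_max ds.
  apply: (bv_derivative_no_atom (a := Num.max delta a0) (b := s + 1)
    (y := A (null_proj A J f)) hip bmu).
  + rewrite int_oy => x /=; rewrite !in_itv/= andbT gt_max.
    by move=> /andP[/andP[-> _] _].
  + move=> x /andP[]; rewrite gt_max => /andP[dx ax] _.
    have x0 := le_lt_trans d0 dx.
    apply: (minimizer_gt_t_star_star hip hY hX hA J_ge0 J_convex J_lsc J_homog hf
      norm_equiv poincare A_weak x0 _ (hu x x0)).
    by rewrite (le_lt_trans ha0) ?lte_fin.
  + by rewrite am ltrDl ltr01.
Qed.
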